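(* Suppose the following hold for the federated compositional problem and the FedCoMuon algorithm described in the context. (1) $F_*:=\inf_{W\in\mathbb R^{m\times n}}F(W)>-\infty$. (2) There are constants $\sigma_g,\sigma_{\nabla g},\sigma_f>0$ such that for all $k\in[K]$, $W\in\mathbb R^{m\times n}$, $y\in\mathbb R^d$: $\mathbb E_{\xi^k}[g^k(W;\xi^k)]=g^k(W)$, $\mathbb E_{\xi^k}[\nabla g^k(W;\xi^k)]=\nabla g^k(W)$, $\mathbb E_{\zeta^k}[\nabla_y f^k(y;\zeta^k)]=\nabla_y f^k(y)$, $\mathbb E_{\xi^k}\|g^k(W;\xi^k)-g^k(W)\|^2\le\sigma_g^2$, $\mathbb E_{\xi^k}\|\nabla g^k(W;\xi^k)-\nabla g^k(W)\|_F^2\le\sigma_{\nabla g}^2$, $\mathbb E_{\zeta^k}\|\nabla_y f^k(y;\zeta^k)-\nabla_y f^k(y)\|^2\le\sigma_f^2$; the samples are independent across clients and iterations, and $\xi^k$ is independent of $\zeta^k$. (3) There are constants $C_g,C_f>0$ such that for all $k,W,y$: $\mathbb E_{\xi^k}\|\nabla g^k(W;\xi^k)\|_F^2\le C_g^2$ and $\mathbb E_{\zeta^k}\|\nabla_y f^k(y;\zeta^k)\|^2\le C_f^2$. (4) There are constants $L_g,L_f$ such that for all $k$, $W_1,W_2$, $y_1,y_2$: $\|\nabla g^k(W_1)-\nabla g^k(W_2)\|_F\le L_g\|W_1-W_2\|_F$ and $\|\nabla_y f^k(y_1)-\nabla_y f^k(y_2)\|\le L_f\|y_1-y_2\|$.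 (5) There is $\delta\ge0$ such that for all $W$: $\frac1K\sum_{k=1}^K\|\nabla F^k(W)-\nabla F(W)\|_F^2\le\delta^2$. Then there is a constant $C$, depending only on $n,K,F(W_0)-F_*$ and the constants in (2)–(5), such that for every integer $T\ge2$ for which $T^{1/4}$ is an integer, FedCoMuon run with $\eta=T^{-3/4}$, $\alpha=\beta=T^{-1/2}$, $\tau=T^{1/4}$ satisfies $$\frac1T\sum_{t=0}^{T-1}\mathbb E\|\nabla F(\bar W_t)\|_F\le C\,T^{-1/4}.$$ Consequently there is a constant $C'$ (with the same dependence) such that for every $\epsilon\in(0,1]$ some such $T$ yields $\frac1T\sum_{t=0}^{T-1}\mathbb E\|\nabla F(\bar W_t)\|_F\le\epsilon$ with $T\le C'\epsilon^{-4}$, with at most $C'\epsilon^{-4}$ stochastic samples drawn per client over the $T$ iterations, and with $T/\tau=T^{3/4}\le C'\epsilon^{-3}$ communication rounds.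
   Context: Problem. Let $K,m,n,d\ge1$ be integers, $[K]=\{1,\dots,K\}$. For each $k\in[K]$ let $\mathcal D_g^k,\mathcal D_f^k$ be probability distributions (possibly different across clients), and let $g^k(W;\xi)\in\mathbb R^d$ ($W\in\mathbb R^{m\times n}$, $\xi\sim\mathcal D_g^k$) and $f^k(y;\zeta)\in\mathbb R$ ($y\in\mathbb R^d$, $\zeta\sim\mathcal D_f^k$) be differentiable in $W$, resp. $y$. Put $g^k(W)=\mathbb E_\xi[g^k(W;\xi)]$, $f^k(y)=\mathbb E_\zeta[f^k(y;\zeta)]$ (also differentiable), $F^k(W)=f^k(g^k(W))$, $F(W)=\frac1K\sum_{k=1}^KF^k(W)$. $\|\cdot\|$ is the Euclidean norm of vectors, $\|\cdot\|_F$ the Frobenius norm, $\otimes$ the Kronecker product, $I_n$ the $n\times n$ identity. The Jacobian $\nabla g^k(W)$ is the $m\times nd$ matrix $[\nabla g^k_1(W),\dots,\nabla g^k_d(W)]$ of the $m\times n$ gradients of the components (similarly for $\nabla g^k(W;\xi)$), so that $\nabla g^k(W)(v\otimes I_n)=\sum_{i=1}^d v_i\nabla g_i^k(W)$ for $v\in\mathbb R^d$ and $\nabla F^k(W)=\nabla g^k(W)(\nabla_yf^k(g^k(W))\otimes I_n)$. FedCoMuon algorithm. Inputs: $\eta>0$, $\alpha,\beta\in[0,1)$, integer $\tau\ge1$, $W_0\in\mathbb R^{m\times n}$. Initialization: each client $k$ draws $\xi_0^k\sim\mathcal D_g^k$, $\zeta_0^k\sim\mathcal D_f^k$ and sets $W_0^k=W_0$,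 $u_0^k=g^k(W_0^k;\xi_0^k)$, and $M_0^k=\nabla g^k(W_0^k;\xi_0^k)(\nabla_yf^k(u_0^k;\zeta_0^k)\otimes I_n)$ (computed locally, not averaged over clients). For $t=0,1,\dots,T-1$, each client $k$ takes a compact singular value decomposition $M_t^k=U_t^k\Sigma_t^k(V_t^k)^\top$ (only nonzero singular values), sets $\tilde W_{t+1}^k=W_t^k-\eta U_t^k(V_t^k)^\top$, draws fresh independent $\xi_{t+1}^k\sim\mathcal D_g^k$, $\zeta_{t+1}^k\sim\mathcal D_f^k$, and sets $u_{t+1}^k=\alpha g^k(\tilde W_{t+1}^k;\xi_{t+1}^k)+(1-\alpha)u_t^k$, $G_{t+1}^k=\nabla g^k(\tilde W_{t+1}^k;\xi_{t+1}^k)(\nabla_yf^k(u_{t+1}^k;\zeta_{t+1}^k)\otimes I_n)$, $\tilde M_{t+1}^k=\beta G_{t+1}^k+(1-\beta)M_t^k$. If $\tau$ divides $t+1$ (a communication round), then $W_{t+1}^k=\frac1K\sum_j\tilde W_{t+1}^j$ and $M_{t+1}^k=\frac1K\sum_j\tilde M_{t+1}^j$ for all $k$ (the $u$'s are not averaged); otherwise $W_{t+1}^k=\tilde W_{t+1}^k$, $M_{t+1}^k=\tilde M_{t+1}^k$. Write $\bar W_t=\frac1K\sum_kW_t^k$. $\mathbb E$ is over all samples. *)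

(* Defs.v *)
From HB Require Import structures.
From mathcomp Require Import all_boot all_order all_algebra.
From mathcomp Require Import all_classical all_reals all_analysis.
From mathcomp.real_closed Require Import mxtens.

Set Implicit Arguments.
Unset Strict Implicit.
Unset Printing Implicit Defensive.

Import Order.TTheory GRing.Theory Num.Theory.
Import numFieldNormedType.Exports.

Local Open Scope classical_set_scope.
Local Open Scope ring_scope.

(* Vectors of R^d are columns 'cV[R]_d, so that [frob] is also the Euclidean
   norm and [grad] is also the gradient of functions on R^d. The norm that
   MathComp-Analysis puts on matrices is the max norm; it is used here only
   through its topology, to speak of differentiability. *)
Section MatrixCalculus.
Context {R : realType}.

Definition frob (m n : nat) (A : 'M[R]_(m, n)) : R :=
  Num.sqrt (\sum_i \sum_j A i j ^+ 2).

Definition grad (m n : nat) (h : 'M[R]_(m, n) -> R) (W : 'M[R]_(m, n)) :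
    'M[R]_(m, n) :=
  \matrix_(i, j) 'D_(delta_mx i j) h W.

(* The block matrix [grad h_1 W, ..., grad h_d W]: the column of index
   [mxtens_index (i, j)], of value i * n + j, is column j of grad h_i W. *)
Definition jac (m n d : nat) (h : 'M[R]_(m, n) -> 'cV[R]_d)
    (W : 'M[R]_(m, n)) : 'M[R]_(m, d * n) :=
  \matrix_(a, c) grad (fun W' => h W' (mxtens_unindex c).1 0) W
                      a (mxtens_unindex c).2.

(* The Kronecker product of v and the identity; the cast identifies the
   column count 1 * n of [tensmx] with n. *)
Definition kron_id (d n : nat) (v : 'cV[R]_d) : 'M[R]_(d * n, n) :=
  castmx (erefl, mul1n n) (tensmx v (1%:M : 'M[R]_n)).

Definition compact_svd (m n r : nat) (A : 'M[R]_(m, n)) (U : 'M[R]_(m, r))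
    (s : 'rV[R]_r) (V : 'M[R]_(n, r)) : Prop :=
  [/\ U^T *m U = 1%:M, V^T *m V = 1%:M, (forall i, 0 < s 0 i)
    & A = U *m diag_mx s *m V^T].

Definition average (K m n : nat) (x : 'I_K -> 'M[R]_(m, n)) : 'M[R]_(m, n) :=
  K%:R^-1 *: \sum_k x k.

End MatrixCalculus.

Section RandomMatrices.
Context {R : realType} {d0 : measure_display} {X : measurableType d0}.
Variable P : probability X R.

Definition integrable_mx (m n : nat) (A : X -> 'M[R]_(m, n)) : Prop :=
  forall i j, P.-integrable [set: X] (fun x => (A x i j)%:E).

Definition expect_mx (m n : nat) (A : X -> 'M[R]_(m, n)) : 'M[R]_(m, n) :=
  \matrix_(i, j) fine 'E_P[fun x => A x i j].

Definition has_mean (m n : nat) (A : X -> 'M[R]_(m, n)) (B : 'M[R]_(m, n)) :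
    Prop :=
  integrable_mx A /\ expect_mx A = B.

Definition mutually_independent (I : finType) (E : I -> set (set X)) : Prop :=
  forall (J : {set I}) (A : I -> set X), (forall i, i \in J -> E i (A i)) ->
    P (\big[setI/[set: X]]_(i in J) A i) = (\prod_(i in J) P (A i))%E.

End RandomMatrices.

(* The data of one client; sample spaces may differ between clients. *)
Record client (R : realType) (m n d : nat) := Client {
  inner_disp : measure_display;
  inner_space : measurableType inner_disp;
  inner_law : probability inner_space R;
  outer_disp : measure_display;
  outer_space : measurableType outer_disp;
  outer_law : probability outer_space R;
  inner : 'M[R]_(m, n) -> inner_space -> 'cV[R]_d;
  outer : 'cV[R]_d -> outer_space -> R }.

Arguments inner {R m n d} c W x.
Arguments outer {R m n d} c y z.

Section Problem.
Context {R : realType} {m n d : nat}.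
Implicit Types (c : client R m n d) (W : 'M[R]_(m, n)) (y : 'cV[R]_d).

Definition inner_mean c W : 'cV[R]_d := expect_mx (inner_law c) (inner c W).

Definition outer_mean c y : R := fine 'E_(outer_law c)[outer c y].

Definition client_obj c W : R := outer_mean c (inner_mean c W).

Definition inner_jac c (x : inner_space c) W : 'M[R]_(m, d * n) :=
  jac (fun W' => inner c W' x) W.

Definition outer_grad c (z : outer_space c) y : 'cV[R]_d :=
  grad (fun y' => outer c y' z) y.

(* Integrability says that the expectations defining the means exist. *)
Record regular_client c : Prop := {
  inner_integrable : forall W, integrable_mx (inner_law c) (inner c W);
  outer_integrable : forall y,
    (outer_law c).-integrable [set: outer_space c]
      (fun z => (outer c y z)%:E);
  inner_differentiable : forall x W, differentiable (fun W' => inner c W' x) W;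
  outer_differentiable : forall z y, differentiable (fun y' => outer c y' z) y;
  inner_mean_differentiable : forall W, differentiable (inner_mean c) W;
  outer_mean_differentiable : forall y, differentiable (outer_mean c) y }.

Definition unbiased c : Prop :=
  [/\ forall W, has_mean (inner_law c) (inner c W) (inner_mean c W),
      forall W, has_mean (inner_law c) (fun x => inner_jac x W)
                  (jac (inner_mean c) W)
    & forall y, has_mean (outer_law c) (fun z => outer_grad z y)
                  (grad (outer_mean c) y)].

Definition bounded_variance (sg sdg sf : R) c : Prop :=
  [/\ forall W, ('E_(inner_law c)
        [fun x => (frob (inner c W x - inner_mean c W) ^+ 2)%R]
          <= (sg ^+ 2)%:E)%E,
      forall W, ('E_(inner_law c)
        [fun x => (frob (inner_jac x W - jac (inner_mean c) W) ^+ 2)%R]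
          <= (sdg ^+ 2)%:E)%E
    & forall y, ('E_(outer_law c)
        [fun z => (frob (outer_grad z y - grad (outer_mean c) y) ^+ 2)%R]
          <= (sf ^+ 2)%:E)%E].

Definition bounded_second_moment (Cg Cf : R) c : Prop :=
  (forall W, ('E_(inner_law c)[fun x => (frob (inner_jac x W) ^+ 2)%R]
     <= (Cg ^+ 2)%:E)%E) /\
  (forall y, ('E_(outer_law c)[fun z => (frob (outer_grad z y) ^+ 2)%R]
     <= (Cf ^+ 2)%:E)%E).

Definition smooth (Lg Lf : R) c : Prop :=
  (forall W1 W2, frob (jac (inner_mean c) W1 - jac (inner_mean c) W2)
                   <= Lg * frob (W1 - W2)) /\
  (forall y1 y2, frob (grad (outer_mean c) y1 - grad (outer_mean c) y2)
                   <= Lf * frob (y1 - y2)).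

Context {K : nat}.
Implicit Type cl : 'I_K -> client R m n d.

Definition objective cl W : R := K%:R^-1 * \sum_k client_obj (cl k) W.

Definition bounded_heterogeneity (delta : R) cl : Prop :=
  forall W, K%:R^-1 * \sum_k
      frob (grad (client_obj (cl k)) W - grad (objective cl) W) ^+ 2
    <= delta ^+ 2.

End Problem.

(* Index of the samples drawn up to time T: client, time, and kind (inner
   samples are tagged [true], outer samples [false]). *)
Definition sample_index (K T : nat) : finType := ('I_K * 'I_T.+1 * bool)%type.

Definition samples_per_client (K T : nat) (k : 'I_K) : nat :=
  #|[set i : sample_index K T | i.1.1 == k]|.

Definition comm_rounds (tau T : nat) : nat :=
  #|[set t : 'I_T | (tau %| t.+1)%N]|.

Section FedCoMuon.
Context {R : realType} {K m n d : nat}.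
Variable cl : 'I_K -> client R m n d.

Section Run.
Context {dO : measure_display} {Omega : measurableType dO}.
Variable P : probability Omega R.
Variable xi : forall k, nat -> {RV P >-> inner_space (cl k)}.
Variable zeta : forall k, nat -> {RV P >-> outer_space (cl k)}.

Definition sample_events (T : nat) (i : sample_index K T) : set (set Omega) :=
  let: (k, t, b) := i in
  if b then preimage_set_system [set: Omega] (xi k t) measurable
  else preimage_set_system [set: Omega] (zeta k t) measurable.

Record fresh_samples (T : nat) : Prop := {
  xi_law : forall k t A, (t <= T)%N -> measurable A ->
    distribution P (xi k t) A = inner_law (cl k) A;
  zeta_law : forall k t A, (t <= T)%N -> measurable A ->
    distribution P (zeta k t) A = outer_law (cl k) A;
  samples_independent : mutually_independent P (@sample_events T) }.

Definition stoch_grad (k : 'I_K) (t : nat) (W : 'M[R]_(m, n)) (u : 'cV[R]_d)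
    (w : Omega) : 'M[R]_(m, n) :=
  inner_jac (xi k t w) W *m kron_id n (outer_grad (zeta k t w) u).

(* [W], [u], [M] are the iterates and [Wt], [Mt] the local iterates before
   communication (written with a tilde); [Wt], [Mt] are used at times >= 1. *)
Record fedcomuon (T : nat) (eta alpha beta : R) (tau : nat)
    (W0 : 'M[R]_(m, n)) (W Wt M Mt : 'I_K -> nat -> Omega -> 'M[R]_(m, n))
    (u : 'I_K -> nat -> Omega -> 'cV[R]_d) : Prop := {
  W_init : forall k w, W k 0%N w = W0;
  u_init : forall k w, u k 0%N w = inner (cl k) (W k 0%N w) (xi k 0%N w);
  M_init : forall k w, M k 0%N w = stoch_grad k 0 (W k 0%N w) (u k 0%N w) w;
  Wt_step : forall k t w, (t < T)%N ->
    exists (r : nat) (U : 'M[R]_(m, r)) (s : 'rV[R]_r) (V : 'M[R]_(n, r)),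
      compact_svd (M k t w) U s V /\
      Wt k t.+1 w = W k t w - eta *: (U *m V^T);
  u_step : forall k t w, (t < T)%N ->
    u k t.+1 w = alpha *: inner (cl k) (Wt k t.+1 w) (xi k t.+1 w)
                 + (1 - alpha) *: u k t w;
  Mt_step : forall k t w, (t < T)%N ->
    Mt k t.+1 w = beta *: stoch_grad k t.+1 (Wt k t.+1 w) (u k t.+1 w) w
                  + (1 - beta) *: M k t w;
  W_step : forall k t w, (t < T)%N ->
    W k t.+1 w = if (tau %| t.+1)%N then average (fun j => Wt j t.+1 w)
                 else Wt k t.+1 w;
  M_step : forall k t w, (t < T)%N ->
    M k t.+1 w = if (tau %| t.+1)%N then average (fun j => Mt j t.+1 w)
                 else Mt k t.+1 w }.

Definition average_grad_norm (T : nat)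
    (W : 'I_K -> nat -> Omega -> 'M[R]_(m, n)) : \bar R :=
  ((T%:R^-1)%:E * \sum_(t < T)
     'E_P[fun w => frob (grad (objective cl) (average (fun k => W k t w)))])%E.

End Run.

(* Every T-iteration run, on any probability space carrying the samples and
   for any choice of singular value decompositions, has average expected
   gradient norm at most b. *)
Definition fedcomuon_bound (W0 : 'M[R]_(m, n)) (T : nat) (eta alpha beta : R)
    (tau : nat) (b : R) : Prop :=
  forall (dO : measure_display) (Omega : measurableType dO)
    (P : probability Omega R)
    (xi : forall k, nat -> {RV P >-> inner_space (cl k)})
    (zeta : forall k, nat -> {RV P >-> outer_space (cl k)})
    (W Wt M Mt : 'I_K -> nat -> Omega -> 'M[R]_(m, n))
    (u : 'I_K -> nat -> Omega -> 'cV[R]_d),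
    fresh_samples xi zeta T ->
    fedcomuon xi zeta T eta alpha beta tau W0 W Wt M Mt u ->
    (average_grad_norm P T W <= b%:E)%E.

End FedCoMuon.

(* Main.v *)
Require Import Defs.
From HB Require Import structures.
From mathcomp Require Import all_boot all_order all_algebra.
From mathcomp Require Import all_classical all_reals all_analysis.
From mathcomp Require Import measurable_realfun.
From mathcomp.real_closed Require Import mxtens.
From mathcomp Require Import ring lra.

Set Implicit Arguments.
Unset Strict Implicit.
Unset Printing Implicit Defensive.

Import Order.TTheory GRing.Theory Num.Theory.
Import numFieldNormedType.Exports.

Local Open Scope classical_set_scope.
Local Open Scope ring_scope.

(** With eta = q^-3, alpha = beta = q^-2, tau = q and T = q^4, the descent lemma
applied to the averaged iterate Wbar reduces the claim to showing that, on
average over t < T and over the clients, E |M_t^k - grad F(Wbar_t)| = O(1/q):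
the update direction U V^T satisfies <M, U V^T> >= |M|_F and |U V^T|_F <= sqrt n.

Within a period of tau steps the clients stay within O(eta tau) = O(q^-2) of
Wbar, and their momenta within O(beta tau) = O(1/q) of the averaged momentum.
Both u and the averaged momentum are exponential averages, and their errors
split into a bias and a noise. For u, measured against g^k(Wbar_t) rather than
g^k at the local iterate (this absorbs the jumps at communication rounds), the
bias is bounded surely by O(eta / alpha + eta tau) = O(1/q). The noise of u, and
the momentum noise [J (h(u; zeta) - h(u))] + [(J - E J) h(g(W))], where J is the
sampled Jacobian and h the gradient of f^k, are sums of martingale differences,
so their second moments are O(alpha) and O(beta) up to the initial transient of
u. What remains of the momentum error is driven by J (h(u) - h(g(W))), estimated
in mean by Cauchy-Schwarz; no fourth moment of J is needed.

Conditioning on the past is done with Tonelli's theorem on the product of the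
sample space, equipped with the sigma-algebra of all samples but the fresh one,
and the law of the fresh sample. This needs the iterates to be measurable in the
samples, for any choice of singular value decompositions: U V^T is the pointwise
limit of the Newton-Schulz iterates of M / |M|, and random fields that are
differentiable in their argument are Caratheodory functions. *)

(** * Frobenius norm, Kronecker products and polar factors *)

Section Frobenius.
Context {R : realType}.

Definition mxdot (m n : nat) (A B : 'M[R]_(m, n)) : R :=
  \sum_i \sum_j A i j * B i j.

(** Read as [c * a t <= a t - a t.+1 + b t], the recursion telescopes. It converts a contraction of
    rate c into a bound of order 1/c on the sum of the [a t]. *)
Lemma sum_recursion_le (a b : nat -> R) (c : R) (N : nat) :
  (forall t, a t.+1 <= (1 - c) * a t + b t) ->
  a N + c * \sum_(t < N) a t <= a 0%N + \sum_(t < N) b t.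
Proof.
move=> ab; elim: N => [|N IH]; first by rewrite !big_ord0 mulr0.
rewrite !big_ord_recr /= mulrDr; have := lerD IH (ab N).
by move: (c * _) (\sum_(i < N) b i) => x y; rewrite mulrBl mul1r; lra.
Qed.

Lemma sum_const_ord (N : nat) (c : R) : \sum_(t < N) c = N%:R * c.
Proof. by rewrite sumr_const card_ord mulr_natl. Qed.

Section Dot.
Context {m n : nat}.
Implicit Types (A B C : 'M[R]_(m, n)) (a b : R).

Lemma mxdotC A B : mxdot A B = mxdot B A.
Proof. by apply: eq_bigr => i _; apply: eq_bigr => j _; rewrite mulrC. Qed.

Lemma mxdotDl A B C : mxdot (A + B) C = mxdot A C + mxdot B C.
Proof.
rewrite -big_split; apply: eq_bigr => i _; rewrite -big_split.
by apply: eq_bigr => j _; rewrite mxE mulrDl.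
Qed.

Lemma mxdotZl a A B : mxdot (a *: A) B = a * mxdot A B.
Proof.
rewrite mulr_sumr; apply: eq_bigr => i _; rewrite mulr_sumr.
by apply: eq_bigr => j _; rewrite mxE mulrA.
Qed.

Lemma mxdotDr A B C : mxdot A (B + C) = mxdot A B + mxdot A C.
Proof. by rewrite !(mxdotC A) mxdotDl. Qed.

Lemma mxdotZr a A B : mxdot A (a *: B) = a * mxdot A B.
Proof. by rewrite !(mxdotC A) mxdotZl. Qed.

Lemma mxdotNl A B : mxdot (- A) B = - mxdot A B.
Proof. by rewrite -scaleN1r mxdotZl mulN1r. Qed.

Lemma mxdotNr A B : mxdot A (- B) = - mxdot A B.
Proof. by rewrite !(mxdotC A) mxdotNl. Qed.

Lemma mxdot0l A : mxdot 0 A = 0.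
Proof. by rewrite -(scale0r A) mxdotZl mul0r. Qed.

Lemma mxdot0r A : mxdot A 0 = 0.
Proof. by rewrite mxdotC mxdot0l. Qed.

Lemma mxdot_suml (I : finType) (F : I -> 'M[R]_(m, n)) B :
  mxdot (\sum_i F i) B = \sum_i mxdot (F i) B.
Proof.
apply: (big_ind2 (fun x y => mxdot x B = y)) => // [|x1 x2 y1 y2 <- <-].
  by rewrite mxdot0l.
by rewrite mxdotDl.
Qed.

Lemma mxdot_sumr (I : finType) (F : I -> 'M[R]_(m, n)) B :
  mxdot B (\sum_i F i) = \sum_i mxdot B (F i).
Proof. by rewrite mxdotC mxdot_suml; apply: eq_bigr => i _; rewrite mxdotC. Qed.

Lemma mxdot_ge0 A : 0 <= mxdot A A.
Proof. by do 2 apply: sumr_ge0 => ? _; rewrite -expr2 sqr_ge0. Qed.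

Lemma mxdot_eq0 A : mxdot A A = 0 -> A = 0.
Proof.
move=> A0; apply/matrixP => i j; rewrite mxE; apply/eqP; rewrite -sqrf_eq0 expr2.
have row0 k : true -> 0 <= \sum_l A k l * A k l.
  by move=> _; apply: sumr_ge0 => l _; rewrite -expr2 sqr_ge0.
have A0i := psumr_eq0P row0 A0 (erefl true : xpredT i).
have entry0 l : true -> 0 <= A i l * A i l by rewrite -expr2 sqr_ge0.
by rewrite (psumr_eq0P entry0 A0i (erefl true : xpredT j)).
Qed.

Lemma frobE A : frob A = Num.sqrt (mxdot A A).
Proof. by []. Qed.

Lemma frob_ge0 A : 0 <= frob A.
Proof. exact: sqrtr_ge0. Qed.

Lemma sqr_frob A : frob A ^+ 2 = mxdot A A.
Proof. by rewrite frobE sqr_sqrtr // mxdot_ge0. Qed.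

Lemma sqr_frobE A : frob A ^+ 2 = \sum_i \sum_j A i j ^+ 2.
Proof. exact: sqr_frob. Qed.

Lemma frob0_eq0 A : frob A = 0 -> A = 0.
Proof. by move=> A0; apply: mxdot_eq0; rewrite -sqr_frob A0 expr0n. Qed.

(** Cauchy-Schwarz: the squared norm of |B| A - |A| B equals 2 |A| |B| (|A| |B| - <A, B>) and is
    nonnegative. *)
Lemma mxdot_le_frob A B : mxdot A B <= frob A * frob B.
Proof.
have [a0|a0] := eqVneq (frob A) 0.
  by rewrite a0 mul0r (frob0_eq0 a0) mxdot0l.
have [b0|b0] := eqVneq (frob B) 0.
  by rewrite b0 mulr0 (frob0_eq0 b0) mxdot0r.
have a_gt0 : 0 < frob A by rewrite lt_neqAle eq_sym a0 frob_ge0.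
have b_gt0 : 0 < frob B by rewrite lt_neqAle eq_sym b0 frob_ge0.
have := mxdot_ge0 (frob B *: A - frob A *: B).
rewrite !(mxdotDl, mxdotDr, mxdotNl, mxdotNr, mxdotZl, mxdotZr).
rewrite (mxdotC B A) -!sqr_frob.
move: (frob A) (frob B) (mxdot A B) a_gt0 b_gt0 => a b c a_gt0 b_gt0.
move=> h; have : 0 <= (a * b) * (2 * (a * b - c)).
  by move: h; congr (0 <= _); ring.
by rewrite pmulr_rge0 ?mulr_gt0 // pmulr_rge0 // subr_ge0.
Qed.

Lemma frobD A B : frob (A + B) <= frob A + frob B.
Proof.
rewrite -(@ler_pXn2r _ 2) // ?nnegrE ?addr_ge0 ?frob_ge0 //.
rewrite sqr_frob mxdotDl !mxdotDr (mxdotC B A) sqrrD !sqr_frob.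
by have := mxdot_le_frob A B; lra.
Qed.

Lemma frobZ a A : frob (a *: A) = `|a| * frob A.
Proof.
by rewrite frobE mxdotZl mxdotZr mulrA -expr2 sqrtrM ?sqr_ge0 // sqrtr_sqr.
Qed.

Lemma frobN A : frob (- A) = frob A.
Proof. by rewrite -scaleN1r frobZ normrN1 mul1r. Qed.

Lemma frob_distC A B : frob (A - B) = frob (B - A).
Proof. by rewrite -frobN opprB. Qed.

Lemma frob0 : frob (0 : 'M[R]_(m, n)) = 0.
Proof. by rewrite frobE mxdot0l sqrtr0. Qed.

Lemma frobB A B : frob (A - B) <= frob A + frob B.
Proof. by rewrite -(frobN B) frobD. Qed.

Lemma frob_dist_triangle C A B : frob (A - B) <= frob (A - C) + frob (C - B).
Proof. by rewrite (le_trans _ (frobD _ _)) // addrA subrK. Qed.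

Lemma frob_sum (I : finType) (F : I -> 'M[R]_(m, n)) :
  frob (\sum_i F i) <= \sum_i frob (F i).
Proof.
apply: (big_ind2 (fun x y => frob x <= y)) => // [|x1 x2 y1 y2 le1 le2].
  by rewrite frob0.
by rewrite (le_trans (frobD _ _)) // lerD.
Qed.

End Dot.

Section Average.
Context {K m n : nat}.
Implicit Types (x y : 'I_K -> 'M[R]_(m, n)).

Lemma averageD x y : average (fun k => x k + y k) = average x + average y.
Proof. by rewrite /average big_split scalerDr. Qed.

Lemma averageZ a x : average (fun k => a *: x k) = a *: average x.
Proof. by rewrite /average -scaler_sumr !scalerA mulrC. Qed.

Lemma averageN x : average (fun k => - x k) = - average x.
Proof. by rewrite /average sumrN scalerN. Qed.

Lemma averageB x y : average (fun k => x k - y k) = average x - average y.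
Proof. by rewrite averageD averageN. Qed.

Lemma average_const (A : 'M[R]_(m, n)) : (0 < K)%N -> average (fun _ : 'I_K => A) = A.
Proof.
move=> K0; rewrite /average sumr_const card_ord -(scaler_nat K A) scalerA mulVf ?scale1r //.
by rewrite pnatr_eq0 -lt0n.
Qed.

Lemma frob_average x : frob (average x) <= K%:R^-1 * \sum_k frob (x k).
Proof. by rewrite frobZ ger0_norm ?invr_ge0 // ler_wpM2l ?invr_ge0 // frob_sum. Qed.

Lemma mean_le (f : 'I_K -> R) c : (0 < K)%N -> (forall k, f k <= c) ->
  K%:R^-1 * \sum_k f k <= c.
Proof.
move=> K0 fc; rewrite ler_pdivrMl ?ltr0n // mulrC mulr_natr.
by rewrite (le_trans (ler_sum _ (fun k _ => fc k))) // sumr_const card_ord.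
Qed.

Lemma mean_const (c : R) : (0 < K)%N -> K%:R^-1 * (\sum_(k < K) c) = c.
Proof.
by move=> K0; rewrite sumr_const card_ord -(mulr_natl c K) mulKf // pnatr_eq0 -lt0n.
Qed.

Lemma frob_average_le x c : (0 < K)%N -> (forall k, frob (x k) <= c) ->
  frob (average x) <= c.
Proof. by move=> K0 xc; rewrite (le_trans (frob_average x)) // mean_le. Qed.

End Average.

Section Kronecker.
Context {m n d : nat}.

Lemma kron_idE (v : 'cV[R]_d) (c : 'I_(d * n)) (j : 'I_n) :
  kron_id n v c j = v (mxtens_unindex c).1 0 * ((mxtens_unindex c).2 == j)%:R.
Proof.
rewrite /kron_id castmxE cast_ord_id -[c in LHS]mxtens_unindexK.
case: (mxtens_unindex c) => i b /=.
have -> : cast_ord (esym (mul1n n)) j = mxtens_index (0 : 'I_1, j).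
  by apply: val_inj; rewrite /= mul0n.
by rewrite tensmxE mxE.
Qed.

Lemma sum_mxtens (f : 'I_(d * n) -> R) :
  \sum_c f c = \sum_i \sum_j f (mxtens_index (i, j)).
Proof.
rewrite pair_big /= (reindex (@mxtens_index d n)) /=.
  by apply: eq_bigr => -[].
by exists (@mxtens_unindex d n) => x _; rewrite ?mxtens_indexK ?mxtens_unindexK.
Qed.

Lemma mul_kron_idE (J : 'M[R]_(m, d * n)) (v : 'cV[R]_d) a b :
  (J *m kron_id n v) a b = \sum_i J a (mxtens_index (i, b)) * v i 0.
Proof.
rewrite mxE sum_mxtens; apply: eq_bigr => i _; rewrite (bigD1 b) //=.
rewrite big1 ?addr0 => [|j jb]; rewrite kron_idE mxtens_indexK /=.
  by rewrite eqxx mulr1.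
by rewrite (negPf jb) !mulr0.
Qed.

Lemma kron_idB (v w : 'cV[R]_d) : kron_id n (v - w) = kron_id n v - kron_id n w.
Proof. by apply/matrixP => c j; rewrite !(mxE, kron_idE) mulrBl. Qed.

Lemma sumr_cauchy (I : finType) (f g : I -> R) :
  (\sum_i f i * g i) ^+ 2 <= (\sum_i f i ^+ 2) * (\sum_i g i ^+ 2).
Proof.
pose A : 'M[R]_(#|I|, 1) := \matrix_(i, _) f (enum_val i).
pose B : 'M[R]_(#|I|, 1) := \matrix_(i, _) g (enum_val i).
have E (h : I -> R) : \sum_i h i = \sum_(i < #|I|) h (enum_val i).
  by rewrite (reindex _ (onW_bij _ (@enum_val_bij I))).
have -> : \sum_i f i * g i = mxdot A B.
  by rewrite E; apply: eq_bigr => i _; rewrite big_ord1 !mxE.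
have -> : \sum_i f i ^+ 2 = frob A ^+ 2.
  by rewrite E sqr_frobE; apply: eq_bigr => i _; rewrite big_ord1 !mxE.
have -> : \sum_i g i ^+ 2 = frob B ^+ 2.
  by rewrite E sqr_frobE; apply: eq_bigr => i _; rewrite big_ord1 !mxE.
rewrite -exprMn -(real_normK (num_real (mxdot A B))).
rewrite ler_pXn2r ?nnegrE ?mulr_ge0 ?frob_ge0 // ler_norml mxdot_le_frob andbT.
by rewrite lerNl -mxdotNl (le_trans (mxdot_le_frob _ _)) // frobN.
Qed.

(** Entry (a, b) of the product pairs v with the entries of row a in column b of every block, so
    Cauchy-Schwarz entry by entry costs only |v|. Using the Frobenius norm of the Kronecker factor
    instead would lose sqrt n. *)
Lemma frob_mul_kron_id (J : 'M[R]_(m, d * n)) (v : 'cV[R]_d) :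
  frob (J *m kron_id n v) <= frob J * frob v.
Proof.
rewrite -(@ler_pXn2r _ 2) ?nnegrE ?mulr_ge0 ?frob_ge0 // exprMn !sqr_frobE.
rewrite mulr_suml ler_sum // => a _; rewrite sum_mxtens exchange_big /=.
rewrite mulr_suml ler_sum // => b _; rewrite mul_kron_idE.
rewrite (le_trans (sumr_cauchy _ _)) // ler_wpM2l //.
  by apply: sumr_ge0 => i _; rewrite sqr_ge0.
by apply: ler_sum => i _; rewrite big_ord1.
Qed.

End Kronecker.

Section SVD.
Context {m n r : nat}.
Implicit Types (A : 'M[R]_(m, n)) (U : 'M[R]_(m, r)) (s : 'rV[R]_r)
  (V : 'M[R]_(n, r)).

Lemma mxdot_trace (p q : nat) (A B : 'M[R]_(p, q)) : mxdot A B = \tr (A^T *m B).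
Proof.
rewrite /mxdot exchange_big; apply: eq_bigr => j _; rewrite mxE.
by apply: eq_bigr => i _; rewrite mxE.
Qed.

(** By cyclicity of the trace the orthonormal factors cancel and only the diagonal ones remain. *)
Lemma mxdot_svd U V (x y : 'rV[R]_r) : U^T *m U = 1%:M -> V^T *m V = 1%:M ->
  mxdot (U *m diag_mx x *m V^T) (U *m diag_mx y *m V^T) = \sum_i x 0 i * y 0 i.
Proof.
move=> UU VV; rewrite mxdot_trace !trmx_mul trmxK tr_diag_mx.
rewrite !mulmxA mxtrace_mulC !mulmxA VV mul1mx -(mulmxA (diag_mx x)) UU mulmx1.
rewrite mulmx_diag mxtrace_diag; apply: eq_bigr => i _.
by rewrite mxE.
Qed.

Lemma polarE U V : U *m V^T = U *m diag_mx (const_mx 1) *m V^T.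
Proof. by rewrite diag_const_mx mulmx1. Qed.

(** The squared norm is the number r of singular values, and r <= n because the identity of size r
    factors as V^T V through dimension n. *)
Lemma svd_frob_polar U V : U^T *m U = 1%:M -> V^T *m V = 1%:M ->
  frob (U *m V^T) <= Num.sqrt n%:R.
Proof.
move=> UU VV; rewrite frobE ler_wsqrtr //.
rewrite polarE mxdot_svd //.
under eq_bigr do rewrite mxE mulr1.
rewrite sumr_const card_ord ler_nat -(mxrank1 R r) -VV.
by rewrite (leq_trans (mxrankM_maxr _ _)) // rank_leq_row.
Qed.

(** The inner product is the nuclear norm of A, a sum of positive singular values, which dominates
    the square root of the sum of their squares. *)
Lemma svd_dot_polar A U s V : compact_svd A U s V -> frob A <= mxdot A (U *m V^T).
Proof.
case=> UU VV s0 ->; rewrite (polarE U V) mxdot_svd //.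
have S0 : 0 <= \sum_i s 0 i by apply: sumr_ge0 => i _; exact: ltW.
under eq_bigr do rewrite mxE mulr1.
rewrite -(@ler_pXn2r _ 2) ?nnegrE ?frob_ge0 // sqr_frob mxdot_svd //.
rewrite expr2 mulr_suml ler_sum // => i _; rewrite ler_wpM2l ?(ltW (s0 i)) //.
by rewrite (bigD1 i) //= lerDl sumr_ge0 // => j _; exact: ltW.
Qed.

End SVD.
End Frobenius.

(** * Gradients *)

Section Calculus.
Context {R : realType}.

Lemma deriveE_grad (m n : nat) (h : 'M[R]_(m, n) -> R) W V :
  differentiable h W -> 'D_V h W = mxdot (grad h W) V.
Proof.
move=> dh; rewrite deriveE // {1}[V]matrix_sum_delta linear_sum.
apply: eq_bigr => i _; rewrite linear_sum; apply: eq_bigr => j _.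
by rewrite linearZ /= mxE deriveE // mulrC.
Qed.

Lemma is_derive_line (m n : nat) (h : 'M[R]_(m, n) -> R) W V (s : R) :
  (forall W, differentiable h W) ->
  is_derive s 1 (fun s => h (s *: V + W)) (mxdot (grad h (s *: V + W)) V).
Proof.
(* The difference quotients of the restriction to the line are those of [h] in direction V at the
   moved point. *)
move=> dh; have E : (fun t : R => t^-1 *: (((fun s => h (s *: V + W)) \o shift s)
    (t *: 1) - h (s *: V + W))) =
    (fun t => t^-1 *: ((h \o shift (s *: V + W)) (t *: V) - h (s *: V + W))).
  by apply/funext => t /=; rewrite [t *: 1]mulr1 scalerDl addrA.
have dW := @diff_derivable _ _ _ h (s *: V + W) V (dh _).
apply: DeriveDef; first by rewrite /derivable E.
by rewrite /derive E -(deriveE_grad V (dh _)).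
Qed.

Lemma grad_MVT (m n : nat) (h : 'M[R]_(m, n) -> R) W V :
  (forall W, differentiable h W) ->
  exists2 s : R, 0 <= s <= 1 & h (V + W) - h W = mxdot (grad h (s *: V + W)) V.
Proof.
move=> dh; have dl s := @is_derive_line m n h W V s dh.
have cl : {within `[0, 1], continuous (fun s : R => h (s *: V + W))}.
  by apply: derivable_within_continuous => s _; case: (dl s).
have [s s01] := MVT_segment ler01 (fun s _ => dl s) cl.
rewrite scale1r scale0r add0r subr0 mulr1 => ->.
by exists s => //; move: s01; rewrite in_itv.
Qed.

Lemma derive_coord (m n p : nat) (g : 'M[R]_(m, n) -> 'cV[R]_p) W V i :
  differentiable g W -> 'D_V (fun W => g W i 0) W = 'D_V g W i 0.
Proof. by move=> dg; rewrite derive_mx ?mxE //; exact: diff_derivable. Qed.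

Lemma differentiable_coord_comp (m n p q : nat) (g : 'M[R]_(m, n) -> 'M[R]_(p, q))
  W i j : differentiable g W -> differentiable (fun W => g W i j) W.
Proof.
move=> dg; apply: (@differentiable_comp _ _ _ _ g (fun N : 'M[R]_(p, q) => N i j)).
  exact: dg.
exact: differentiable_coord.
Qed.

Lemma grad_comp (m n d : nat) (g : 'M[R]_(m, n) -> 'cV[R]_d)
    (f : 'cV[R]_d -> R) W :
  differentiable g W -> differentiable f (g W) ->
  grad (f \o g) W = jac g W *m kron_id n (grad f (g W)).
Proof.
move=> dg df; apply/matrixP => a b; rewrite mul_kron_idE mxE.
rewrite deriveE; last exact: differentiable_comp.
rewrite diff_comp //= -deriveE // deriveE_grad //.
apply: eq_bigr => i _; rewrite big_ord1 mulrC; congr (_ * _).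
by rewrite -deriveE // -derive_coord // mxE mxtens_indexK /= mxE.
Qed.

(** Pairing with a fixed matrix is used in [frob_lipschitz] to reduce a vector-valued map to a
    scalar one. *)
Lemma grad_mxdot (m n : nat) (A W : 'M[R]_(m, n)) :
  differentiable (fun y => mxdot y A) W /\ grad (fun y => mxdot y A) W = A.
Proof.
have lin : linear (fun y => mxdot y A : R).
  by move=> a u v; rewrite mxdotDl mxdotZl.
pose fM := GRing.isLinear.Build _ _ _ _ _ lin.
pose f : {linear 'M[R]_(m, n) -> R} := HB.pack (fun y : 'M[R]_(m, n) => mxdot y A) fM.
have cf : continuous f.
  have FM (M : 'M[R]_(m, n)) : Filter (nbhs M) by exact: nbhs_filter.
  move=> M; apply: (@cvg_big _ _ _ _ _ (@add_continuous _) _ (nbhs M)) => i _.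
  apply: (@cvg_big _ _ _ _ _ (@add_continuous _) _ (nbhs M)) => j _.
  by apply: cvgM; [exact: coord_continuous|exact: cvg_cst].
split; first exact: (@linear_differentiable _ _ _ f).
apply/matrixP => i j; rewrite mxE deriveE; last exact: (@linear_differentiable _ _ _ f).
rewrite (@diff_lin _ _ _ f) //= /f /= /mxdot (bigD1 i) //= (bigD1 j) //= big1.
  rewrite addr0 big1 ?addr0 => [|k ki]; first by rewrite mxE !eqxx mul1r.
  by apply: big1 => l _; rewrite mxE (negPf ki) mul0r.
by move=> l lj; rewrite mxE eqxx (negPf lj) mul0r.
Qed.

(** The mean value theorem is applied to the scalar function <g, a> with a = g W1 - g W2. It gives
    |a|^2 <= C |a| |W1 - W2|, and |a| cancels. *)
Lemma frob_lipschitz (m n d : nat) (g : 'M[R]_(m, n) -> 'cV[R]_d) (C : R) W1 W2 :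
  (forall W, differentiable g W) -> (forall W, frob (jac g W) <= C) ->
  frob (g W1 - g W2) <= C * frob (W1 - W2).
Proof.
move=> dg gC; pose a := g W1 - g W2.
have [a0|/eqP a0] := eqVneq (frob a) 0.
  rewrite -/a a0 mulr_ge0 ?frob_ge0 //.
  by apply: le_trans (gC W1); exact: frob_ge0.
have a_gt0 : 0 < frob a by rewrite lt_neqAle eq_sym frob_ge0 andbT; apply/eqP.
have df y : differentiable (fun y => mxdot y a) y by case: (grad_mxdot a y).
have dfg W : differentiable ((fun y => mxdot y a) \o g) W by exact: differentiable_comp.
have [s _] := grad_MVT W2 (W1 - W2) dfg.
rewrite subrK /= -mxdotNl -mxdotDl -/a -sqr_frob => E.
have : frob a ^+ 2 <= C * frob a * frob (W1 - W2).
  rewrite E (le_trans (mxdot_le_frob _ _)) // ler_wpM2r ?frob_ge0 //.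
  rewrite grad_comp // (le_trans (frob_mul_kron_id _ _)) //.
  by rewrite (proj2 (grad_mxdot a _)) ler_wpM2r ?frob_ge0.
by rewrite mulrAC expr2 ler_pM2r.
Qed.

(** The mean value theorem supplies the gradient at an intermediate point, which the Lipschitz bound
    compares with the gradient at W. This yields the constant L instead of L / 2, without any
    integration. *)
Lemma descent_lemma (m n : nat) (h : 'M[R]_(m, n) -> R) (L : R) W V :
  0 <= L -> (forall W, differentiable h W) ->
  (forall W1 W2, frob (grad h W1 - grad h W2) <= L * frob (W1 - W2)) ->
  h (V + W) <= h W + mxdot (grad h W) V + L * frob V ^+ 2.
Proof.
move=> L0 dh lip; have [s /andP[s0 s1] E] := grad_MVT W V dh.
rewrite -addrA -lerBlDl E -lerBlDl -mxdotNl -mxdotDl.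
rewrite (le_trans (mxdot_le_frob _ _)) // expr2 mulrA ler_wpM2r ?frob_ge0 //.
rewrite (le_trans (lip _ _)) // addrK frobZ ger0_norm // ler_wpM2l //.
by rewrite ler_piMl ?frob_ge0.
Qed.

End Calculus.

(** * Measurability *)

Section MeasurableMatrices.
Context {R : realType} {dT : measure_display} {T : measurableType dT}.

Definition measurable_mx (m n : nat) (A : T -> 'M[R]_(m, n)) : Prop :=
  forall i j, measurable_fun [set: T] (fun x => A x i j).

Lemma measurable_mx_cst (m n : nat) (A : 'M[R]_(m, n)) : measurable_mx (fun _ => A).
Proof. by move=> i j; exact: measurable_cst. Qed.

Lemma measurable_mxD (m n : nat) (A B : T -> 'M[R]_(m, n)) :
  measurable_mx A -> measurable_mx B -> measurable_mx (fun x => A x + B x).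
Proof.
move=> mA mB i j; under eq_fun do rewrite mxE.
exact: measurable_funD.
Qed.

Lemma measurable_mxZ (m n : nat) (a : T -> R) (A : T -> 'M[R]_(m, n)) :
  measurable_fun [set: T] a -> measurable_mx A ->
  measurable_mx (fun x => a x *: A x).
Proof.
move=> ma mA i j; under eq_fun do rewrite mxE.
exact: measurable_funM.
Qed.

Lemma measurable_mxZl (m n : nat) (a : R) (A : T -> 'M[R]_(m, n)) :
  measurable_mx A -> measurable_mx (fun x => a *: A x).
Proof. by move=> mA; apply: measurable_mxZ => //; exact: measurable_cst. Qed.

Lemma measurable_mxN (m n : nat) (A : T -> 'M[R]_(m, n)) :
  measurable_mx A -> measurable_mx (fun x => - A x).
Proof.
move=> mA; under [X in measurable_mx X]eq_fun do rewrite -scaleN1r.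
exact: measurable_mxZl.
Qed.

Lemma measurable_mxB (m n : nat) (A B : T -> 'M[R]_(m, n)) :
  measurable_mx A -> measurable_mx B -> measurable_mx (fun x => A x - B x).
Proof. by move=> mA mB; apply: measurable_mxD => //; exact: measurable_mxN. Qed.

Lemma measurable_mxM (m n p : nat) (A : T -> 'M[R]_(m, n)) (B : T -> 'M[R]_(n, p)) :
  measurable_mx A -> measurable_mx B -> measurable_mx (fun x => A x *m B x).
Proof.
move=> mA mB i j; under eq_fun do rewrite mxE.
by apply: measurable_sum => k; exact: measurable_funM.
Qed.

Lemma measurable_mx_tr (m n : nat) (A : T -> 'M[R]_(m, n)) :
  measurable_mx A -> measurable_mx (fun x => (A x)^T).
Proof. by move=> mA i j; under eq_fun do rewrite mxE; exact: mA. Qed.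

Lemma measurable_average (K m n : nat) (A : 'I_K -> T -> 'M[R]_(m, n)) :
  (forall k, measurable_mx (A k)) -> measurable_mx (fun x => average (fun k => A k x)).
Proof.
move=> mA; apply: measurable_mxZl => i j.
under eq_fun do rewrite summxE.
by apply: measurable_sum => k; exact: mA.
Qed.

Lemma measurable_kron_id (n d : nat) (v : T -> 'cV[R]_d) :
  measurable_mx v -> measurable_mx (fun x => kron_id n (v x)).
Proof.
move=> mv i j; under eq_fun do rewrite kron_idE.
by apply: measurable_funM => //; exact: measurable_cst.
Qed.

Lemma measurable_mxdot (m n : nat) (A B : T -> 'M[R]_(m, n)) :
  measurable_mx A -> measurable_mx B ->
  measurable_fun [set: T] (fun x => mxdot (A x) (B x)).
Proof.
move=> mA mB; apply: measurable_sum => i; apply: measurable_sum => j.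
exact: measurable_funM.
Qed.

Lemma measurable_frob (m n : nat) (A : T -> 'M[R]_(m, n)) :
  measurable_mx A -> measurable_fun [set: T] (fun x => frob (A x)).
Proof.
move=> mA; under eq_fun do rewrite frobE.
have ms : measurable_fun [set: R] (@Num.Def.sqrtr R).
  by apply: continuous_measurable_fun; exact: sqrt_continuous.
exact: (measurableT_comp ms (measurable_mxdot mA mA)).
Qed.

Lemma cvg_mx_entry (m n : nat) (u : nat -> 'M[R]_(m, n)) (A : 'M[R]_(m, n)) :
  (forall N i j, `|A i j - u N i j| <= harmonic N) -> u @ \oo --> A.
Proof.
move=> uA; apply/cvgrPdist_le => /= e e0; near=> N.
rewrite [leLHS]/Num.Def.normr/= mx_normrE (bigmax_le _ (ltW e0))//= => i _.
rewrite !mxE (le_trans (uA _ _ _)) //; near: N.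
have /cvgrPdist_le/(_ _ e0) := @cvg_harmonic R.
apply: filterS => N; rewrite sub0r normrN; apply: le_trans.
exact: ler_norm.
Unshelve. all: by end_near. Qed.

Lemma measurable_floor (f : T -> R) (z : int) : measurable_fun [set: T] f ->
  measurable [set x | Num.floor (f x) = z].
Proof.
move=> mf; have -> : [set x | Num.floor (f x) = z] =
    [set: T] `&` f @^-1` `[z%:~R, (z + 1)%:~R[%classic.
  rewrite setTI; apply/seteqP; split => x /=; rewrite in_itv /=.
    by move=> <-; exact: floor_itv.
  exact: floor_def.
exact: (mf measurableT _ (measurable_itv _)).
Qed.

(* A Caratheodory function is jointly measurable: the matrix argument is
   rounded to the grid of mesh 1/(N+1), where it takes countably many values. *)
Lemma measurable_caratheodory (m n : nat) (dY : measure_display)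
    (Y : measurableType dY) (h : 'M[R]_(m, n) -> Y -> R)
    (A : T -> 'M[R]_(m, n)) (y : T -> Y) :
  (forall v, continuous (h ^~ v)) ->
  (forall W, measurable_fun [set: Y] (h W)) ->
  measurable_mx A -> measurable_fun [set: T] y ->
  measurable_fun [set: T] (fun x => h (A x) (y x)).
Proof.
move=> ch mh mA my.
pose fl N x i j : int := Num.floor (N.+1%:R * A x i j).
pose grid N (Z : 'M[int]_(m, n)) : 'M[R]_(m, n) :=
  \matrix_(i, j) ((Z i j)%:~R / N.+1%:R).
pose rnd N x := grid N (\matrix_(i, j) fl N x i j).
apply: (@measurable_fun_cvg _ _ _ _ (fun N x => h (rnd N x) (y x))) => [N|x _].
  move=> _ B mB; rewrite setTI.
  have -> : (fun x => h (rnd N x) (y x)) @^-1` B = \bigcup_(Z : 'M[int]_(m, n))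
      ((\bigcap_(ij : 'I_m * 'I_n) [set x | fl N x ij.1 ij.2 = Z ij.1 ij.2]) `&`
       ([set: T] `&` (fun x => h (grid N Z) (y x)) @^-1` B)).
    apply/seteqP; split=> x /=.
      move=> Bx; exists (\matrix_(i, j) fl N x i j) => //; split => //.
      by move=> ij _; rewrite /= mxE.
    case=> Z _ [xZ [_]]; rewrite /preimage /= /rnd.
    suff -> : \matrix_(i, j) fl N x i j = Z by [].
    by apply/matrixP => i j; rewrite mxE; exact: (xZ (i, j)).
  apply: countable_bigcupT_measurable => // Z; apply: measurableI.
    apply: fin_bigcap_measurable => // -[i j] _.
    by apply: measurable_floor; apply: measurable_funM.
  exact: (measurableT_comp (mh _) my).
have rndA : rnd ^~ x @ \oo --> A x.
  apply: cvg_mx_entry => N i j; rewrite !mxE.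
  have N0 : 0 < N.+1%:R :> R by [].
  have /andP[le1 lt1] := floor_itv (N.+1%:R * A x i j).
  rewrite -[A x i j in X in X <= _](mulKf (lt0r_neq0 N0)) mulrC -mulrBl normrM.
  rewrite [`|_^-1|]ger0_norm ?invr_ge0 // /harmonic ler_piMl ?invr_ge0 //.
  rewrite ger0_norm ?subr_ge0 // lerBlDl; apply: ltW.
  by move: lt1; rewrite intrD.
exact: (@cvg_comp _ _ _ (rnd ^~ x) (h ^~ (y x)) _ _ _ rndA (ch (y x) (A x))).
Qed.

(** The directional derivative is the limit of the difference quotients of step 1/(N+1), each built
    from two Caratheodory evaluations. *)
Lemma measurable_derive (m n : nat) (dY : measure_display)
    (Y : measurableType dY) (h : 'M[R]_(m, n) -> Y -> R)
    (A : T -> 'M[R]_(m, n)) (y : T -> Y) (V : 'M[R]_(m, n)) :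
  (forall v W, differentiable (h ^~ v) W) ->
  (forall W, measurable_fun [set: Y] (h W)) ->
  measurable_mx A -> measurable_fun [set: T] y ->
  measurable_fun [set: T] (fun x => 'D_V (h ^~ (y x)) (A x)).
Proof.
move=> dh mh mA my.
have ch v : continuous (h ^~ v).
  by move=> W; apply: differentiable_continuous; exact: dh.
pose t N : R := harmonic N.
apply: (@measurable_fun_cvg _ _ _ _ (fun N x => (t N)^-1 *
    (h (t N *: V + A x) (y x) - h (A x) (y x)))) => [N|x _].
  apply: measurable_funM; first exact: measurable_cst.
  apply: measurable_funB; apply: measurable_caratheodory => //.
  by apply: measurable_mxD => //; exact: measurable_mx_cst.
have /(_ V) := @diff_derivable _ _ _ (h ^~ (y x)) (A x) _ (dh _ _).
rewrite /derivable => dV.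
(* The steps never vanish, so they converge to 0 along the punctured neighbourhoods in which
   derivatives are defined. *)
have t0 : t @ \oo --> 0^'.
  move=> P /= P0; have := @cvg_harmonic R _ P0.
  have tN N : t N != 0 by rewrite /t /= gt_eqF // invr_gt0.
  rewrite /nbhs /= /fmap /=.
  by apply: (@filterS _ \oo) => N /=; apply; exact: tN.
exact: (@cvg_comp _ _ _ t _ _ _ _ t0 dV).
Qed.

End MeasurableMatrices.

(** * Measurability of the polar factor *)

Section Polar.
Context {R : realType}.

(* Newton-Schulz iteration: it acts on the singular values by
   [s |-> (3 s - s^3) / 2], whose iterates tend to 1 on ]0, 1]. *)
Definition newton_schulz (m n : nat) (A : 'M[R]_(m, n)) : 'M[R]_(m, n) :=
  (3 / 2) *: A - 2^-1 *: (A *m A^T *m A).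

Definition newton_schulz_sv (s : R) : R := 3 / 2 * s - 2^-1 * s ^+ 3.

(** In A A^T A the products U^T U and V^T V cancel, so the iteration keeps the singular vectors and
    acts on the diagonal alone. *)
Lemma newton_schulz_svd (m n r : nat) (U : 'M[R]_(m, r)) (V : 'M[R]_(n, r))
    (s : 'rV[R]_r) : U^T *m U = 1%:M -> V^T *m V = 1%:M ->
  newton_schulz (U *m diag_mx s *m V^T) =
  U *m diag_mx (map_mx newton_schulz_sv s) *m V^T.
Proof.
move=> UU VV; rewrite /newton_schulz !trmx_mul trmxK tr_diag_mx.
have -> : U *m diag_mx s *m V^T *m (V *m (diag_mx s *m U^T)) *m
    (U *m diag_mx s *m V^T) =
    U *m (diag_mx s *m diag_mx s *m diag_mx s) *m V^T.
  by rewrite !mulmxA -(mulmxA _ V^T V) VV mulmx1 -(mulmxA _ U^T U) UU mulmx1.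
rewrite !mulmx_diag [X in X - _]scalemxAl [X in _ - X]scalemxAl -mulmxBl.
rewrite [X in X - _]scalemxAr [X in _ - X]scalemxAr -mulmxBr.
congr (_ *m _ *m _); apply/matrixP => i j; rewrite !mxE.
by rewrite /newton_schulz_sv; case: (i == j); rewrite ?mulr1n ?mulr0n; ring.
Qed.

(** On [s, 1] the map does not decrease t and multiplies 1 - t by 1 - t/2 - t^2/2. The interval is
    therefore preserved, and the contraction factor 1 - s/2 is uniform along an orbit started at
    s. *)
Lemma newton_schulz_sv_bounds (s t : R) : 0 < s -> s <= t <= 1 ->
  s <= newton_schulz_sv t <= 1 /\
  1 - newton_schulz_sv t <= (1 - s / 2) * (1 - t).
Proof.
move=> s0 /andP[st t1]; have E : newton_schulz_sv t = t + 2^-1 * (t * ((1 - t) * (1 + t))).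
  by rewrite /newton_schulz_sv; field.
have E1 : 1 - newton_schulz_sv t = (1 - t) * (1 - t / 2 - t ^+ 2 / 2).
  by rewrite /newton_schulz_sv; field.
have t0 : 0 < t by exact: lt_le_trans st.
have q0 : 0 <= t * ((1 - t) * (1 + t)) by rewrite !mulr_ge0 //; lra.
have t2 : 0 <= t ^+ 2 by exact: sqr_ge0.
split; last by rewrite E1 mulrC ler_wpM2r //; lra.
apply/andP; split; first by rewrite E; lra.
by rewrite -subr_ge0 E1 mulr_ge0 //; nra.
Qed.

Lemma cvg_newton_schulz_sv (s : R) : 0 < s <= 1 ->
  (fun N => iter N newton_schulz_sv s) @ \oo --> (1 : R).
Proof.
move=> /andP[s0 s1].
have H N : s <= iter N newton_schulz_sv s <= 1 /\
    1 - iter N newton_schulz_sv s <= (1 - s / 2) ^+ N.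
  elim: N => [|N [b IH]].
    by rewrite /= expr0 lexx s1; split => //; rewrite lerBlDr lerDl ltW.
  have [b' le'] := newton_schulz_sv_bounds s0 b; split=> //=.
  by rewrite (le_trans le') // exprS ler_wpM2l //; lra.
apply/cvgrPdist_le => e e0; near=> N.
have [/andP[_ le1] leN] := H N.
rewrite ger0_norm ?subr_ge0 // (le_trans leN) //.
rewrite (le_trans (ler_norm _)) //; near: N.
have lt1 : `|1 - s / 2| < 1 by rewrite ger0_norm; lra.
have /cvgrPdist_le/(_ _ e0) := @cvg_expr R _ lt1.
by apply: filterS => N /=; rewrite sub0r normrN.
Unshelve. all: by end_near. Qed.

(** The factor U V^T is the limit of polynomial expressions in M / |M|, whatever decomposition is
    chosen. Hence it is measurable even when r, U and V are selected outcome by outcome with no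
    regularity. *)
Lemma measurable_polar {dT : measure_display} {T : measurableType dT}
    (m n : nat) (M O : T -> 'M[R]_(m, n)) :
  measurable_mx M ->
  (forall x, exists (r : nat) (U : 'M[R]_(m, r)) (s : 'rV[R]_r) (V : 'M[R]_(n, r)),
     compact_svd (M x) U s V /\ O x = U *m V^T) ->
  measurable_mx O.
Proof.
move=> mM svdM i j.
(* Dividing by the Frobenius norm puts the singular values in ]0, 1]. If M x = 0 then r = 0, and the
   iterates and U V^T all vanish. *)
pose A N x := iter N (@newton_schulz m n) (powR (frob (M x)) (-1) *: M x).
have mA N : measurable_mx (A N).
  elim: N => [|N IH].
    apply: measurable_mxZ => //.
    exact: (measurableT_comp (measurable_powR (-1)) (measurable_frob mM)).
  apply: measurable_mxB; apply: measurable_mxZl => //.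
  by apply: measurable_mxM => //; apply: measurable_mxM => //; exact: measurable_mx_tr.
apply: (@measurable_fun_cvg _ _ _ _ (fun N x => A N x i j)) => [N|x _].
  exact: mA.
have [r [U [s [V [[UU VV s0 EM] ->]]]]] := svdM x.
pose c := (frob (M x))^-1.
have c01 k : 0 < c * s 0 k <= 1.
  have sk : s 0 k <= frob (M x).
    rewrite -(@ler_pXn2r _ 2) ?nnegrE ?frob_ge0 ?(ltW (s0 k)) // sqr_frob EM mxdot_svd //.
    by rewrite (bigD1 k) //= -expr2 lerDl sumr_ge0 // => l _; rewrite -expr2 sqr_ge0.
  have M0 : 0 < frob (M x) by exact: lt_le_trans (s0 k) sk.
  by rewrite mulr_gt0 ?invr_gt0 //= /c ler_pdivrMl // mulr1.
have AE N : A N x = U *m diag_mx (\row_k iter N newton_schulz_sv (c * s 0 k)) *m V^T.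
  elim: N => [|N IH].
    rewrite /A /= powR_inv1 ?frob_ge0 // -/c {1}EM scalemxAl scalemxAr -linearZ.
    by congr (_ *m diag_mx _ *m _); apply/matrixP => a b; rewrite !mxE ord1.
  rewrite /A iterS -/(A N x) IH newton_schulz_svd //.
  by congr (_ *m diag_mx _ *m _); apply/matrixP => a b; rewrite !mxE.
under [X in X @ _]eq_fun do rewrite AE mxE.
rewrite polarE mxE.
apply: (@cvg_big _ _ _ _ _ (@add_continuous _)) => k _.
rewrite (_ : (fun x0 : nat => _) =
    (fun N => U i k * iter N newton_schulz_sv (c * s 0 k) * V^T k j)).
  rewrite mul_mx_diag !mxE; apply: cvgMl; apply: cvgMr.
  exact: cvg_newton_schulz_sv.
by apply/funext => N; rewrite mul_mx_diag !mxE.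
Qed.

End Polar.

(** * Independence and expectation bounds *)

Section Tonelli.
Context {R : realType} {dO dS dY : measure_display} {Omega : measurableType dO}
  {S : measurableType dS} {Y : measurableType dY}.
Variables (P : probability Omega R) (law : probability Y R).
Variables (X : Omega -> S) (y : Omega -> Y).
Hypotheses (mX : measurable_fun [set: Omega] X) (my : measurable_fun [set: Omega] y).
Hypothesis indep : forall A B, measurable A -> measurable B ->
  P (X @^-1` A `&` y @^-1` B) = (P (X @^-1` A) * law B)%E.

Let mXy : measurable_fun [set: Omega] (fun w => (X w, y w)).
Proof. exact: measurable_fun_pair. Qed.

Let X_mfun_mixin := isMeasurableFun.Build _ _ _ _ _ mX.
Let X_mfun : {mfun Omega >-> S} := HB.pack X X_mfun_mixin.
Let Xy_mfun_mixin := isMeasurableFun.Build _ _ _ _ _ mXy.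
Let Xy_mfun : {mfun Omega >-> (S * Y)%type} :=
  HB.pack (fun w => (X w, y w)) Xy_mfun_mixin.
Let PX : probability S R := distribution P X_mfun.
Let PXy : probability (S * Y)%type R := distribution P Xy_mfun.

(** Independence makes the joint law of (X, y) agree with the product law on rectangles, hence
    everywhere; Tonelli's theorem then integrates y out first. *)
Lemma independent_tonelli (psi : S * Y -> \bar R) :
  measurable_fun [set: S * Y] psi -> (forall z, (0 <= psi z)%E) ->
  (\int[P]_w psi (X w, y w) = \int[P]_w \int[law]_v psi (X w, v))%E.
Proof.
move=> mpsi psi0.
have EP A : measurable A -> (PX \x law)%E A = PXy A.
  apply: product_measure_unique => {A} A B mA mB.
  by rewrite -[RHS]indep.
have /= <- := @ge0_integral_distribution _ _ _ _ _ P Xy_mfun _ mpsi psi0.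
transitivity (\int[(PX \x law)%E]_z psi z)%E.
  by apply: eq_measure_integral => A mA _; exact/esym/EP.
rewrite fubini_tonelli1 //.
rewrite (@ge0_integral_distribution _ _ _ _ _ P X_mfun) //.
  exact: measurable_fun_fubini_tonelli_F.
by move=> s; apply: integral_ge0 => v _.
Qed.

End Tonelli.

(** * Independence of one sample from all the others *)

Section Others.
Context {R : realType} {dO : measure_display} {Omega : measurableType dO}.
Variables (P : probability Omega R) (I : finType) (E : I -> set (set Omega)).

(** A pi-system, closed under intersection, that generates the sigma-algebra of all samples but
    [i0]. *)
Definition others (i0 : I) : set (set Omega) :=
  [set B | exists2 A : I -> set Omega, (forall i, E i (A i)) &
     B = \big[setI/[set: Omega]]_(i in [set~ i0]%SET) A i].

Hypothesis Emeas : forall i, E i `<=` measurable.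
Hypothesis ET : forall i, E i setT.
Hypothesis EI : forall i, setI_closed (E i).
Hypothesis indep : mutually_independent P E.

Lemma others_measurable i0 : others i0 `<=` measurable.
Proof.
move=> _ [A EA ->]; apply: bigsetI_measurable => i _.
exact: Emeas.
Qed.

Lemma setI_closed_others i0 : setI_closed (others i0).
Proof.
move=> _ _ [A EA ->] [B EB ->]; exists (fun i => A i `&` B i).
  by move=> i; exact: EI.
by rewrite big_split.
Qed.

Lemma others_setT i0 : others i0 setT.
Proof. by exists (fun _ => setT) => //; rewrite big1. Qed.

Lemma sub_others i i0 : i != i0 -> E i `<=` others i0.
Proof.
move=> ii0 B EB; exists (fun j => if j == i then B else setT).
  by move=> j; case: eqP => [->|].
rewrite (bigD1 i) /=; last by rewrite !inE.
by rewrite eqxx big1 ?setIT // => j /andP[_ /negPf ->].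
Qed.

(** For fixed C both sides are finite measures in B. They agree on the pi-system [others], hence on
    the sigma-algebra it generates. *)
Lemma independent_others i0 B C : <<s others i0 >> B -> E i0 C ->
  P (B `&` C) = (P B * P C)%E.
Proof.
move=> sB EC; have mC := Emeas EC.
have PC0 : 0 <= fine (P C) by exact: fine_ge0.
have EPC : P C = (fine (P C))%:E by rewrite fineK // fin_num_measure.
pose m1 : {measure set Omega -> \bar R} := mrestr P mC.
pose m2 : {measure set Omega -> \bar R} := mscale (NngNum PC0) P.
have -> : P (B `&` C) = m1 B by [].
have -> : (P B * P C)%E = m2 B by rewrite /m2 /= /mscale /= muleC EPC.
apply: (@g_sigma_algebra_measure_unique _ _ _ (others i0) (@others_measurable i0)
   (fun _ => setT)) => //.
- by move=> _; exact: others_setT.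
- by rewrite bigcup_const.
- exact: setI_closed_others.
- move=> _ [A EA ->]; rewrite /m1 /m2 /= /mrestr /mscale /= -EPC muleC.
  (* Inserting C at index [i0] completes the intersection to one over all indices, to which mutual
     independence applies. *)
  pose A' j := if j == i0 then C else A j.
  have EA' j : E j (A' j) by rewrite /A'; case: eqP => [->|].
  have A'E j : j \in [set~ i0]%SET -> A' j = A j.
    by rewrite !inE /A' => /negPf ->.
  have := @indep [set: I]%SET A' (fun j _ => EA' j).
  rewrite (bigD1 i0) //= (bigD1 i0 (P := mem [set: I]%SET)) //= {1 3}/A' eqxx.
  have H j : (j \in [set: I]%SET) && (j != i0) = (j \in [set~ i0]%SET) by rewrite !inE.
  rewrite (eq_bigl _ _ H) (eq_bigl _ _ H) (eq_bigr _ A'E) setIC => ->.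
  rewrite muleC; congr (_ * _)%E.
  rewrite (eq_bigr (P \o A)) => [|j /A'E -> //].
  by rewrite indep.
- by move=> _; rewrite /m1 /= /mrestr (le_lt_trans (probability_le1 _ _)) ?ltry //;
    exact: measurableI.
Qed.

End Others.

(** * Centered noise and second moments *)

Section Noise.
Context {R : realType} {dY : measure_display} {Y : measurableType dY}.
Variable law : probability Y R.

Definition centered (f : Y -> R) : Prop :=
  law.-integrable [set: Y] (fun v => (f v)%:E) /\ (\int[law]_v (f v)%:E = 0)%E.

Definition centered_mx (m n : nat) (D : Y -> 'M[R]_(m, n)) : Prop :=
  forall i j, centered (fun v => D v i j).

Lemma eq_centered f g : f =1 g -> centered f -> centered g.
Proof. by move=> /funext ->. Qed.

Lemma centeredZ (a : R) f : centered f -> centered (fun v => a * f v).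
Proof.
case=> intf f0; split.
  by under eq_fun do rewrite EFinM; exact: integrableZl.
by under eq_integral do rewrite EFinM; rewrite integralZl // f0 mule0.
Qed.

Lemma centered_sum (I : finType) (f : I -> Y -> R) :
  (forall i, centered (f i)) -> centered (fun v => \sum_i f i v).
Proof.
move=> cf; split.
  under eq_fun do rewrite -sumEFin.
  by apply: integrable_sum => // i _; case: (cf i).
under eq_integral do rewrite -sumEFin.
rewrite integral_sum // => [|i]; last by case: (cf i).
by rewrite big1 // => i _; case: (cf i).
Qed.

Lemma centered_mxdot (m n : nat) (D : Y -> 'M[R]_(m, n)) (Z : 'M[R]_(m, n)) :
  centered_mx D -> centered (fun v => mxdot Z (D v)).
Proof.
move=> cD; apply: centered_sum => i; apply: centered_sum => j.
exact: centeredZ.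
Qed.

Lemma centered_mxZ (m n : nat) (a : R) (D : Y -> 'M[R]_(m, n)) :
  centered_mx D -> centered_mx (fun v => a *: D v).
Proof.
move=> cD i j; apply: eq_centered (centeredZ a (cD i j)) => v.
by rewrite mxE.
Qed.

Lemma centered_mulmxr (m n p : nat) (D : Y -> 'M[R]_(m, n)) (Q : 'M[R]_(n, p)) :
  centered_mx D -> centered_mx (fun v => D v *m Q).
Proof.
move=> cD i j.
apply: (@eq_centered (fun v => \sum_k Q k j * D v i k)) => [v|].
  by rewrite mxE; apply: eq_bigr => k _; rewrite mulrC.
by apply: centered_sum => k; exact: centeredZ.
Qed.

Lemma centered_mulmxl (m n p : nat) (D : Y -> 'M[R]_(n, p)) (Q : 'M[R]_(m, n)) :
  centered_mx D -> centered_mx (fun v => Q *m D v).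
Proof.
move=> cD i j.
apply: (@eq_centered (fun v => \sum_k Q i k * D v k j)) => [v|].
  by rewrite mxE.
by apply: centered_sum => k; exact: centeredZ.
Qed.

Lemma centered_kron_id (n d : nat) (D : Y -> 'cV[R]_d) :
  centered_mx D -> centered_mx (fun v => kron_id n (D v)).
Proof.
move=> cD c j.
apply: (@eq_centered
  (fun v => ((mxtens_unindex c).2 == j)%:R * D v (mxtens_unindex c).1 0)) => [v|].
  by rewrite kron_idE mulrC.
exact: centeredZ.
Qed.

Lemma has_mean_centered (m n : nat) (A : Y -> 'M[R]_(m, n)) B :
  has_mean law A B -> centered_mx (fun v => A v - B).
Proof.
case=> intA EA i j; have Eij : fine (\int[law]_v (A v i j)%:E) = B i j.
  by rewrite -EA mxE unlock.
have c : law.-integrable [set: Y] (fun=> (- B i j)%:E).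
  exact: finite_measure_integrable_cst.
have E : (fun v => ((A v - B) i j)%:E) = (fun v => (A v i j)%:E + (- B i j)%:E)%E.
  by apply/funext => v; rewrite !mxE EFinD.
split; rewrite E; first exact: integrableD.
rewrite integralD // integral_cst //= probability_setT mule1 -Eij.
by rewrite EFinN fineK ?subee // integrable_fin_num.
Qed.

(** Pythagoras: the cross term 2 <Z, D> integrates to zero. The finite second moment allows the
    integral to be split. *)
Lemma integral_sqr_frobD (m n : nat) (D : Y -> 'M[R]_(m, n)) (Z : 'M[R]_(m, n)) :
  centered_mx D -> (\int[law]_v (frob (D v) ^+ 2)%:E < +oo)%E ->
  (\int[law]_v (frob (Z + D v) ^+ 2)%:E =
     (frob Z ^+ 2)%:E + \int[law]_v (frob (D v) ^+ 2)%:E)%E.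
Proof.
move=> cD Dfin.
have mD : measurable_mx D.
  by move=> i j; have [/integrableP[/measurable_EFinP]] := cD i j.
have iD : law.-integrable [set: Y] (fun v => (frob (D v) ^+ 2)%:E).
  apply/integrableP; split.
    by apply/measurable_EFinP/measurable_funX/measurable_frob.
  under eq_integral do rewrite abse_EFin ger0_norm ?sqr_ge0 //.
  exact: Dfin.
have [iZ Z0] := centeredZ 2 (centered_mxdot Z cD).
have ic : law.-integrable [set: Y] (fun=> (frob Z ^+ 2)%:E).
  exact: finite_measure_integrable_cst.
under eq_integral => v _.
  have -> : (frob (Z + D v) ^+ 2)%:E =
      ((frob Z ^+ 2)%:E + ((2 * mxdot Z (D v))%:E + (frob (D v) ^+ 2)%:E))%E.
    rewrite -!EFinD; congr EFin.
    rewrite !sqr_frob mxdotDl !mxdotDr (mxdotC (D v) Z); ring.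
  over.
rewrite integralD //; last exact: integrableD.
by rewrite integralD // Z0 add0e integral_cst //= probability_setT mule1.
Qed.

(** Jensen's inequality for the squared norm, read off from Pythagoras with Z = B and D = A - B; the
    variance bound supplies the finiteness. *)
Lemma sqr_frob_mean_le (m n : nat) (A : Y -> 'M[R]_(m, n)) B (s c : R) :
  has_mean law A B ->
  ('E_law[fun v => (frob (A v - B) ^+ 2)%R] <= s%:E)%E ->
  ('E_law[fun v => (frob (A v) ^+ 2)%R] <= c%:E)%E -> frob B ^+ 2 <= c.
Proof.
rewrite unlock => /has_mean_centered cA As Ac.
have := integral_sqr_frobD B cA (le_lt_trans As (ltry _)).
under eq_integral do rewrite addrC subrK.
move=> E; rewrite -lee_fin; apply: le_trans Ac; rewrite E leeDl //.
by apply: integral_ge0 => v _; rewrite lee_fin sqr_ge0.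
Qed.

End Noise.

(** * Calculus of bounds in expectation *)

Section ExpectationBounds.
Context {R : realType} {dO : measure_display} {Omega : measurableType dO}.
Variable P : probability Omega R.

(** Measurability and nonnegativity are bundled with the bound so that estimates add, scale and
    compare with no separate integrability to carry. *)
Definition mean_bounded (f : Omega -> R) (b : R) : Prop :=
  [/\ measurable_fun [set: Omega] f, forall w, 0 <= f w
    & (\int[P]_w (f w)%:E <= b%:E)%E].

Lemma mean_bounded_ge0 f b : mean_bounded f b -> 0 <= b.
Proof.
case=> _ f0 fb; rewrite -lee_fin (le_trans _ fb) // integral_ge0 // => w _.
by rewrite lee_fin.
Qed.

Lemma mean_bounded_cst (b : R) : 0 <= b -> mean_bounded (fun _ => b) b.
Proof.
by move=> b0; split => //; rewrite integral_cst //= probability_setT mule1.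
Qed.

Lemma mean_boundedD (f g : Omega -> R) a b :
  mean_bounded f a -> mean_bounded g b -> mean_bounded (fun w => f w + g w) (a + b).
Proof.
case=> mf f0 fa [mg g0 gb]; split.
- exact: measurable_funD.
- by move=> w; rewrite addr_ge0.
- under eq_integral do rewrite EFinD.
  rewrite ge0_integralD //=; first by rewrite EFinD leeD.
  + by move=> w _; rewrite lee_fin.
  + exact/measurable_EFinP.
  + by move=> w _; rewrite lee_fin.
  + exact/measurable_EFinP.
Qed.

Lemma mean_boundedZ (c : R) (f : Omega -> R) a : 0 <= c ->
  mean_bounded f a -> mean_bounded (fun w => c * f w) (c * a).
Proof.
move=> c0 [mf f0 fa]; split.
- by apply: measurable_funM.
- by move=> w; rewrite mulr_ge0.
- under eq_integral do rewrite EFinM.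
  rewrite ge0_integralZl //=.
  + by rewrite EFinM lee_pmul // ?lee_fin // integral_ge0 // => w _; rewrite lee_fin.
  + exact/measurable_EFinP.
  + by move=> w _; rewrite lee_fin.
Qed.

Lemma mean_bounded_sum (I : finType) (f : I -> Omega -> R) (a : I -> R) :
  (forall i, mean_bounded (f i) (a i)) ->
  mean_bounded (fun w => \sum_i f i w) (\sum_i a i).
Proof.
move=> fa; elim: (index_enum I) => [|i s IH].
  rewrite big_nil; under [X in mean_bounded X]eq_fun do rewrite big_nil.
  exact: mean_bounded_cst.
rewrite big_cons; under [X in mean_bounded X]eq_fun do rewrite big_cons.
exact: mean_boundedD.
Qed.

Lemma mean_bounded_le (f g : Omega -> R) b : measurable_fun [set: Omega] f ->
  (forall w, 0 <= f w <= g w) -> mean_bounded g b -> mean_bounded f b.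
Proof.
move=> mf fg [mg g0 gb]; split=> //.
  by move=> w; case/andP: (fg w).
apply: le_trans gb; apply: ge0_le_integral => //.
- by move=> w _; rewrite lee_fin; case/andP: (fg w).
- exact/measurable_EFinP.
- exact/measurable_EFinP.
- by move=> w _; rewrite lee_fin; case/andP: (fg w).
Qed.

Lemma mean_bounded_weaken f a b : a <= b -> mean_bounded f a -> mean_bounded f b.
Proof. by move=> ab [mf f0 fa]; split=> //; apply: le_trans fa _; rewrite lee_fin. Qed.

End ExpectationBounds.

Section Fresh.
Context {R : realType} {dO dY : measure_display} {Omega : measurableType dO}
  {Y : measurableType dY}.
Variables (P : probability Omega R) (law : probability Y R).
Variables (I : finType) (E : I -> set (set Omega)) (i0 : I) (y : Omega -> Y).
Hypothesis Emeas : forall i, E i `<=` measurable.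
Hypothesis ET : forall i, E i setT.
Hypothesis EI : forall i, setI_closed (E i).
Hypothesis indep : mutually_independent P E.
Hypothesis Ey : E i0 = preimage_set_system [set: Omega] y measurable.
Hypothesis ylaw : forall A, measurable A -> P (y @^-1` A) = law A.

(* The sample space with the sigma-algebra of all the samples but [i0]. *)
Local Notation past := (g_sigma_algebraType (others E i0)).

Lemma measurable_fun_sample : measurable_fun [set: Omega] y.
Proof.
by move=> _ B mB; apply: (@Emeas i0); rewrite Ey; exists B.
Qed.

Lemma measurable_id_past : measurable_fun [set: Omega] (id : Omega -> past).
Proof.
move=> _ B mB; rewrite setTI.
have sub := smallest_sub (@sigma_algebra_measurable _ Omega)
  (@others_measurable _ _ _ E Emeas i0).
exact: sub.
Qed.

Lemma fresh_tonelli (psi : past * Y -> \bar R) :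
  measurable_fun [set: past * Y] psi -> (forall z, (0 <= psi z)%E) ->
  (\int[P]_w psi (w : past, y w) = \int[P]_w \int[law]_v psi (w : past, v))%E.
Proof.
apply: (@independent_tonelli _ _ _ _ _ _ _ P law (id : Omega -> past) y
  measurable_id_past measurable_fun_sample).
move=> A B mA mB; rewrite -ylaw //.
apply: (@independent_others _ _ _ _ _ _ Emeas ET EI indep i0) => //.
by rewrite Ey; exists B => //; rewrite setTI.
Qed.

(** This plays the role of conditioning on the past: the fresh sample is integrated out with the
    others frozen, which leaves at most c, and c is then averaged. Measurability of [psi] with
    respect to [past] says that its first argument carries no information on the fresh sample beyond
    the other samples. *)
Lemma mean_bounded_fresh (psi : Omega -> Y -> R) (c : Omega -> R) (b : R) :
  measurable_fun [set: past * Y] (fun z => psi z.1 z.2) ->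
  (forall w v, 0 <= psi w v) ->
  (forall w, (\int[law]_v (psi w v)%:E <= (c w)%:E)%E) ->
  mean_bounded P c b ->
  mean_bounded P (fun w => psi w (y w)) b.
Proof.
move=> mpsi psi0 psic [mc c0 cb].
have mE : measurable_fun [set: past * Y] (fun z => (psi z.1 z.2)%:E).
  exact/measurable_EFinP.
split=> //.
  have mp := measurable_fun_pair measurable_id_past measurable_fun_sample.
  exact: (measurableT_comp mpsi mp).
have -> : (\int[P]_w (psi w (y w))%:E = \int[P]_w \int[law]_v (psi w v)%:E)%E.
  by apply: (fresh_tonelli mE) => z; rewrite lee_fin.
apply: le_trans cb; apply: ge0_le_integral => //.
- by move=> w _; apply: integral_ge0 => v _; rewrite lee_fin.
- have mF := @measurable_fun_fubini_tonelli_F _ _ past Y R law _ mE.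
  apply: (measurableT_comp (mF _) measurable_id_past) => z.
  by rewrite lee_fin.
- exact/measurable_EFinP.
Qed.

End Fresh.

Section NoiseBounds.
Context {R : realType} {dY : measure_display} {Y : measurableType dY}.
Variable law : probability Y R.

Lemma centered_measurable (m n : nat) (D : Y -> 'M[R]_(m, n)) :
  centered_mx law D -> measurable_mx D.
Proof. by move=> cD i j; have [/integrableP[/measurable_EFinP]] := cD i j. Qed.

Lemma mean_bounded_sqr_frob (m n : nat) (D : Y -> 'M[R]_(m, n)) (s : R) :
  centered_mx law D -> (\int[law]_v (frob (D v) ^+ 2)%:E <= s%:E)%E ->
  mean_bounded law (fun v => frob (D v) ^+ 2) s.
Proof.
move=> cD Ds; split=> // [|v]; last exact: sqr_ge0.
by apply: measurable_funX; apply: measurable_frob; exact: centered_measurable cD.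
Qed.

Lemma mean_bounded_add_noise (m n : nat) (D : Y -> 'M[R]_(m, n)) (Z : 'M[R]_(m, n))
    (a s : R) :
  centered_mx law D -> mean_bounded law (fun v => frob (D v) ^+ 2) s ->
  mean_bounded law (fun v => frob (Z + a *: D v) ^+ 2) (frob Z ^+ 2 + a ^+ 2 * s).
Proof.
move=> cD Ds; have caD := centered_mxZ a cD.
have [maD _ aDs] : mean_bounded law (fun v => frob (a *: D v) ^+ 2) (a ^+ 2 * s).
  under [X in mean_bounded _ X]eq_fun do rewrite frobZ exprMn real_normK ?num_real //.
  by apply: mean_boundedZ; rewrite ?sqr_ge0.
split=> [|v|]; last 1 first.
- rewrite integral_sqr_frobD //; first by rewrite EFinD leeD2l.
  exact: le_lt_trans aDs (ltry _).
- apply: measurable_funX; apply: measurable_frob; apply: measurable_mxD.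
    exact: measurable_mx_cst.
  exact: centered_measurable caD.
- exact: sqr_ge0.
Qed.

End NoiseBounds.

(** * The clients and the objective *)

Section Client.
Context {R : realType} {m n d : nat}.
Variable c : client R m n d.
Variables (sg sdg sf Cg Cf Lg Lf : R).
Hypotheses (Cg0 : 0 < Cg) (Cf0 : 0 < Cf).
Hypotheses (reg : regular_client c) (unb : unbiased c)
  (var : bounded_variance sg sdg sf c) (mom : bounded_second_moment Cg Cf c)
  (smo : smooth Lg Lf c).

(** Product rule for the gradient J h(g): one term varies J, the other varies h through g, each step
    through g costing Cg. The absolute values are there because Lg and Lf come with no sign. *)
Definition grad_lipschitz_constant : R := Cf * `|Lg| + Cg ^+ 2 * `|Lf|.
Local Notation L := grad_lipschitz_constant.

Lemma grad_lipschitz_constant_ge0 : 0 <= L.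
Proof. by rewrite addr_ge0 // mulr_ge0 // ?sqr_ge0 // ltW. Qed.

Lemma frob_jac_inner_mean W : frob (jac (inner_mean c) W) <= Cg.
Proof.
case: unb => _ mJ _; case: var => _ vJ _; case: mom => sJ _.
rewrite -(@ler_pXn2r _ 2) ?nnegrE ?frob_ge0 ?(ltW Cg0) //.
exact: sqr_frob_mean_le (mJ W) (vJ W) (sJ W).
Qed.

Lemma frob_grad_outer_mean y : frob (grad (outer_mean c) y) <= Cf.
Proof.
case: unb => _ _ mh; case: var => _ _ vh; case: mom => _ sh.
rewrite -(@ler_pXn2r _ 2) ?nnegrE ?frob_ge0 ?(ltW Cf0) //.
exact: sqr_frob_mean_le (mh y) (vh y) (sh y).
Qed.

Lemma inner_mean_lipschitz W1 W2 :
  frob (inner_mean c W1 - inner_mean c W2) <= Cg * frob (W1 - W2).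
Proof.
apply: frob_lipschitz; first exact: inner_mean_differentiable.
exact: frob_jac_inner_mean.
Qed.

Lemma jac_inner_mean_lipschitz W1 W2 :
  frob (jac (inner_mean c) W1 - jac (inner_mean c) W2) <= `|Lg| * frob (W1 - W2).
Proof.
case: smo => lJ _; apply: le_trans (lJ W1 W2) _.
by rewrite ler_wpM2r ?frob_ge0 ?ler_norm.
Qed.

Lemma grad_outer_mean_lipschitz y1 y2 :
  frob (grad (outer_mean c) y1 - grad (outer_mean c) y2) <= `|Lf| * frob (y1 - y2).
Proof.
case: smo => _ lh; apply: le_trans (lh y1 y2) _.
by rewrite ler_wpM2r ?frob_ge0 ?ler_norm.
Qed.

Lemma client_obj_differentiable W : differentiable (client_obj c) W.
Proof.
apply: (@differentiable_comp _ _ _ _ (inner_mean c) (outer_mean c)).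
  exact: inner_mean_differentiable.
exact: outer_mean_differentiable.
Qed.

Lemma grad_client_obj W : grad (client_obj c) W =
  jac (inner_mean c) W *m kron_id n (grad (outer_mean c) (inner_mean c W)).
Proof.
apply: (@grad_comp _ _ _ _ (inner_mean c) (outer_mean c)).
  exact: inner_mean_differentiable.
exact: outer_mean_differentiable.
Qed.

Lemma frob_grad_client_obj W : frob (grad (client_obj c) W) <= Cg * Cf.
Proof.
rewrite grad_client_obj (le_trans (frob_mul_kron_id _ _)) //.
by rewrite ler_pM ?frob_ge0 ?frob_jac_inner_mean ?frob_grad_outer_mean.
Qed.

Lemma grad_client_obj_lipschitz W1 W2 :
  frob (grad (client_obj c) W1 - grad (client_obj c) W2) <= L * frob (W1 - W2).
Proof.
rewrite !grad_client_obj.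
set J1 := jac _ W1; set J2 := jac _ W2; set h1 := grad _ _; set h2 := grad _ (_ W2).
have -> : J1 *m kron_id n h1 - J2 *m kron_id n h2 =
    (J1 - J2) *m kron_id n h1 + J2 *m kron_id n (h1 - h2).
  by rewrite kron_idB mulmxBl mulmxBr addrA subrK.
rewrite (le_trans (frobD _ _)) // /L mulrDl lerD //.
  rewrite (le_trans (frob_mul_kron_id _ _)) // mulrC -mulrA.
  by rewrite ler_pM ?frob_ge0 ?frob_grad_outer_mean ?jac_inner_mean_lipschitz.
rewrite (le_trans (frob_mul_kron_id _ _)) // expr2 -!mulrA.
rewrite ler_pM ?frob_ge0 ?frob_jac_inner_mean //.
rewrite (le_trans (grad_outer_mean_lipschitz _ _)) // mulrCA ler_wpM2l //.
exact: inner_mean_lipschitz.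
Qed.

Section Measurability.
Context {dT : measure_display} {T : measurableType dT}.
Variables (A : T -> 'M[R]_(m, n)) (y : T -> 'cV[R]_d).
Variables (x : T -> inner_space c) (z : T -> outer_space c).
Hypotheses (mA : measurable_mx A) (my : measurable_mx y)
  (mx : measurable_fun [set: T] x) (mz : measurable_fun [set: T] z).

Let measurable_inner_cst W i : measurable_fun [set: inner_space c]
  (fun x => inner c W x i 0).
Proof.
by have /(_ W i 0)/integrableP[/measurable_EFinP] := inner_integrable reg.
Qed.

Let measurable_outer_cst y0 : measurable_fun [set: outer_space c] (outer c y0).
Proof.
by have /(_ y0)/integrableP[/measurable_EFinP] := outer_integrable reg.
Qed.

Lemma measurable_inner : measurable_mx (fun t => inner c (A t) (x t)).
Proof.
move=> i j; rewrite ord1.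
apply: (measurable_caratheodory (h := fun W v => inner c W v i 0)) => // v W.
apply: differentiable_continuous; apply: differentiable_coord_comp.
exact: inner_differentiable.
Qed.

Lemma measurable_inner_jac : measurable_mx (fun t => inner_jac (x t) (A t)).
Proof.
move=> a b; under eq_fun do rewrite !mxE.
set i := (mxtens_unindex b).1; set j := (mxtens_unindex b).2.
apply: (measurable_derive (h := fun W v => inner c W v i 0)) => // v W.
by apply: differentiable_coord_comp; exact: inner_differentiable.
Qed.

Lemma measurable_outer_grad : measurable_mx (fun t => outer_grad (z t) (y t)).
Proof.
move=> i j; under eq_fun do rewrite !mxE.
apply: (measurable_derive (h := fun y v => outer c y v)) => // v W.
exact: outer_differentiable.
Qed.

Lemma measurable_inner_mean : measurable_mx (fun t => inner_mean c (A t)).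
Proof.
move=> i j.
apply: (measurable_caratheodory (h := fun W (_ : T) => inner_mean c W i j)
  (y := id)) => // v W.
apply: differentiable_continuous; apply: differentiable_coord_comp.
exact: inner_mean_differentiable.
Qed.

Lemma measurable_jac_inner_mean : measurable_mx (fun t => jac (inner_mean c) (A t)).
Proof.
move=> a b; under eq_fun do rewrite !mxE.
set i := (mxtens_unindex b).1; set j := (mxtens_unindex b).2.
apply: (measurable_derive (h := fun W (_ : T) => inner_mean c W i 0)
  (y := id)) => // v W.
by apply: differentiable_coord_comp; exact: inner_mean_differentiable.
Qed.

Lemma measurable_grad_outer_mean : measurable_mx (fun t => grad (outer_mean c) (y t)).
Proof.
move=> i j; under eq_fun do rewrite !mxE.
apply: (measurable_derive (h := fun y (_ : T) => outer_mean c y) (y := id)) => // v W.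
exact: outer_mean_differentiable.
Qed.

End Measurability.

Lemma measurable_grad_client_obj (dT : measure_display) (T : measurableType dT)
    (A : T -> 'M[R]_(m, n)) :
  measurable_mx A -> measurable_mx (fun t => grad (client_obj c) (A t)).
Proof.
move=> mA; under [X in measurable_mx X]eq_fun do rewrite grad_client_obj.
apply: measurable_mxM; first exact: measurable_jac_inner_mean.
apply: measurable_kron_id; apply: measurable_grad_outer_mean.
exact: measurable_inner_mean.
Qed.

Lemma centered_inner W :
  centered_mx (inner_law c) (fun x => inner c W x - inner_mean c W).
Proof. by case: unb => mg _ _; exact: has_mean_centered. Qed.

Lemma centered_inner_jac W :
  centered_mx (inner_law c) (fun x => inner_jac x W - jac (inner_mean c) W).
Proof. by case: unb => _ mJ _; exact: has_mean_centered. Qed.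

Lemma centered_outer_grad y :
  centered_mx (outer_law c) (fun z => outer_grad z y - grad (outer_mean c) y).
Proof. by case: unb => _ _ mh; exact: has_mean_centered. Qed.

Lemma integral_inner_variance W :
  (\int[inner_law c]_x (frob (inner c W x - inner_mean c W) ^+ 2)%:E <= (sg ^+ 2)%:E)%E.
Proof. by case: var => vg _ _; have := vg W; rewrite unlock. Qed.

Lemma integral_inner_jac_variance W :
  (\int[inner_law c]_x (frob (inner_jac x W - jac (inner_mean c) W) ^+ 2)%:E
    <= (sdg ^+ 2)%:E)%E.
Proof. by case: var => _ vJ _; have := vJ W; rewrite unlock. Qed.

Lemma integral_outer_grad_variance y :
  (\int[outer_law c]_z (frob (outer_grad z y - grad (outer_mean c) y) ^+ 2)%:E
    <= (sf ^+ 2)%:E)%E.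
Proof. by case: var => _ _ vh; have := vh y; rewrite unlock. Qed.

Lemma integral_sqr_inner_jac W :
  (\int[inner_law c]_x (frob (inner_jac x W) ^+ 2)%:E <= (Cg ^+ 2)%:E)%E.
Proof. by case: mom => sJ _; have := sJ W; rewrite unlock. Qed.

Lemma integral_sqr_outer_grad y :
  (\int[outer_law c]_z (frob (outer_grad z y) ^+ 2)%:E <= (Cf ^+ 2)%:E)%E.
Proof. by case: mom => _ sh; have := sh y; rewrite unlock. Qed.

End Client.

Section Objective.
Context {R : realType} {K m n d : nat}.
Variable cl : 'I_K -> client R m n d.
Variable L : R.
Hypotheses (K0 : (0 < K)%N) (L0 : 0 <= L).
Hypothesis dcl : forall k W, differentiable (client_obj (cl k)) W.
Hypothesis lcl : forall k W1 W2,
  frob (grad (client_obj (cl k)) W1 - grad (client_obj (cl k)) W2)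
    <= L * frob (W1 - W2).

Lemma objective_differentiable W : differentiable (objective cl) W.
Proof.
have dsum : differentiable (\sum_(k < K) client_obj (cl k)) W.
  by apply: differentiable_sum.
rewrite (_ : objective cl = K%:R^-1 *: \sum_(k < K) client_obj (cl k)).
  exact: differentiableZ.
by apply/funext => V; rewrite /objective fct_sumE.
Qed.

Lemma grad_objective W :
  grad (objective cl) W = average (fun k => grad (client_obj (cl k)) W).
Proof.
apply/matrixP => i j; rewrite !mxE summxE.
rewrite (_ : objective cl = K%:R^-1 *: \sum_(k < K) client_obj (cl k)); last first.
  by apply/funext => V; rewrite /objective fct_sumE.
have dk k : derivable (client_obj (cl k)) W (delta_mx i j).
  exact: diff_derivable.
rewrite deriveZ; last by apply: derivable_sum.
rewrite derive_sum //; congr (_ * _); apply: eq_bigr => k _.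
by rewrite mxE.
Qed.

Lemma grad_objective_lipschitz W1 W2 :
  frob (grad (objective cl) W1 - grad (objective cl) W2) <= L * frob (W1 - W2).
Proof.
rewrite !grad_objective -averageN -averageD.
exact: frob_average_le.
Qed.

End Objective.

(** * Runs of the algorithm *)

Section Run.
Context {R : realType} {K m n d : nat}.
Variable cl : 'I_K -> client R m n d.
Variables (sg sdg sf Cg Cf Lg Lf : R).
Context {dO : measure_display} {Omega : measurableType dO}.
Variable P : probability Omega R.
Variable xi : forall k, nat -> {RV P >-> inner_space (cl k)}.
Variable zeta : forall k, nat -> {RV P >-> outer_space (cl k)}.
Variables (T : nat) (eta alpha beta : R) (tau : nat) (W0 : 'M[R]_(m, n)).
Variables (W Wt M Mt : 'I_K -> nat -> Omega -> 'M[R]_(m, n)).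
Variable u : 'I_K -> nat -> Omega -> 'cV[R]_d.

Hypotheses (K0 : (0 < K)%N) (Cg0 : 0 < Cg) (Cf0 : 0 < Cf).
Hypotheses (reg : forall k, regular_client (cl k))
  (unb : forall k, unbiased (cl k))
  (var : forall k, bounded_variance sg sdg sf (cl k))
  (mom : forall k, bounded_second_moment Cg Cf (cl k))
  (smo : forall k, smooth Lg Lf (cl k)).
Hypotheses (eta0 : 0 < eta) (alpha01 : 0 < alpha <= 1) (beta01 : 0 < beta <= 1)
  (tau0 : (0 < tau)%N).
Hypothesis fresh : fresh_samples xi zeta T.
Hypothesis run : fedcomuon xi zeta T eta alpha beta tau W0 W Wt M Mt u.

Local Notation sn := (Num.sqrt (n%:R : R)).
Local Notation L := (grad_lipschitz_constant Cg Cf Lg Lf).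

(* The point at which the samples of time [t] are used. *)
Definition query (k : 'I_K) (t : nat) (w : Omega) : 'M[R]_(m, n) :=
  if t is 0 then W0 else Wt k t w.

Definition Wbar (t : nat) (w : Omega) := average (fun k => W k t w).
Definition Mbar (t : nat) (w : Omega) := average (fun k => M k t w).

Definition sampled_jac k t w := inner_jac (xi k t w) (query k t w).
Definition sampled_grad k t w :=
  sampled_jac k t w *m kron_id n (outer_grad (zeta k t w) (u k t w)).

Definition inner_noise k t w :=
  inner (cl k) (query k t w) (xi k t w) - inner_mean (cl k) (query k t w).

Definition query_grad k t w :=
  grad (outer_mean (cl k)) (inner_mean (cl k) (query k t w)).

(** Centered given the past and xi_t: u_t is determined by them, and only zeta_t remains free. *)
Definition outer_noise k t w := sampled_jac k t w *m
  kron_id n (outer_grad (zeta k t w) (u k t w) - grad (outer_mean (cl k)) (u k t w)).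

(** The outer gradient is taken at the exact inner value and not at u_t, because u_t depends on xi_t
    and would spoil the centering. *)
Definition jac_noise k t w :=
  (sampled_jac k t w - jac (inner_mean (cl k)) (query k t w)) *m
  kron_id n (query_grad k t w).

(* Contributions of the centered noises to u and to the momenta. *)
Fixpoint u_noise k t w : 'cV[R]_d :=
  if t is s.+1 then (1 - alpha) *: u_noise k s w + alpha *: inner_noise k t w
  else inner_noise k 0%N w.

Fixpoint M_noise k t w : 'M[R]_(m, n) :=
  if t is s.+1 then
    ((1 - beta) *: M_noise k s w + beta *: jac_noise k t w) + beta *: outer_noise k t w
  else 0.

(** The factor 2 adds the distances to a common anchor of one client and of the average. *)
Definition consensus_radius : R := 2 * (eta * sn * tau%:R).
Local Notation rho := consensus_radius.

(** The stationary size of the bias of u: the motion of [Wbar] accumulates over about 1/alpha steps,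
    while the gap between query point and [Wbar] enters with weight alpha. *)
Definition u_drift : R := Cg * (eta * sn / alpha + rho).

Let alpha_gt0 : 0 < alpha. Proof. by case/andP: alpha01. Qed.
Let alpha_le1 : alpha <= 1. Proof. by case/andP: alpha01. Qed.
Let beta_gt0 : 0 < beta. Proof. by case/andP: beta01. Qed.
Let beta_le1 : beta <= 1. Proof. by case/andP: beta01. Qed.
Let sn0 : 0 <= sn. Proof. exact: sqrtr_ge0. Qed.
Let etasn0 : 0 <= eta * sn. Proof. by rewrite mulr_ge0 // ltW. Qed.

Lemma consensus_radius_ge0 : 0 <= rho.
Proof. by rewrite mulr_ge0 // mulr_ge0. Qed.

Lemma u_drift_ge0 : 0 <= u_drift.
Proof.
by rewrite mulr_ge0 ?(ltW Cg0) // addr_ge0 ?consensus_radius_ge0 // divr_ge0 // ltW.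
Qed.

Let L0 : 0 <= L. Proof. exact: grad_lipschitz_constant_ge0. Qed.
Let dcl k V : differentiable (client_obj (cl k)) V.
Proof. exact: client_obj_differentiable. Qed.
Let lcl k W1 W2 : frob (grad (client_obj (cl k)) W1 - grad (client_obj (cl k)) W2)
    <= L * frob (W1 - W2).
Proof. exact: (@grad_client_obj_lipschitz _ _ _ _ (cl k) sg sdg sf). Qed.

Lemma u_at0 k w : u k 0 w = inner (cl k) (query k 0 w) (xi k 0%N w).
Proof. by rewrite (u_init run) (W_init run). Qed.

Lemma u_succ k t w : (t < T)%N ->
  u k t.+1 w = alpha *: inner (cl k) (query k t.+1 w) (xi k t.+1 w)
    + (1 - alpha) *: u k t w.
Proof. exact: u_step run _ _ _. Qed.

Lemma M_at0 k w : M k 0 w = sampled_grad k 0 w.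
Proof. by rewrite (M_init run) /stoch_grad (W_init run). Qed.

Lemma Mt_succ k t w : (t < T)%N ->
  Mt k t.+1 w = beta *: sampled_grad k t.+1 w + (1 - beta) *: M k t w.
Proof. exact: Mt_step run _ _ _. Qed.

Lemma Wbar0 w : Wbar 0 w = W0.
Proof.
have E : (fun k => W k 0 w) = fun=> W0 by apply/funext => k; rewrite (W_init run).
by rewrite /Wbar E average_const.
Qed.

(** Communication leaves the mean unchanged, so [Wbar] obeys one recursion at all times. *)
Lemma Wbar_succ t w : (t < T)%N -> Wbar t.+1 w = average (fun k => Wt k t.+1 w).
Proof.
move=> tT; have E k := W_step run k w tT.
rewrite /Wbar; have [dt|/negPf dt] := boolP (tau %| t.+1)%N; rewrite dt in E.
  by rewrite (funext E) average_const.
by rewrite (funext E).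
Qed.

Lemma Mbar_succ t w : (t < T)%N -> Mbar t.+1 w = average (fun k => Mt k t.+1 w).
Proof.
move=> tT; have E k := M_step run k w tT.
rewrite /Mbar; have [dt|/negPf dt] := boolP (tau %| t.+1)%N; rewrite dt in E.
  by rewrite (funext E) average_const.
by rewrite (funext E).
Qed.

(** Recovered from the iterates, since the decomposition is only asserted to exist at each outcome;
    [directionP] identifies it with U V^T. *)
Definition direction k t w := eta^-1 *: (W k t w - Wt k t.+1 w).

Lemma directionP k t w : (t < T)%N ->
  exists (r : nat) (U : 'M[R]_(m, r)) (s : 'rV[R]_r) (V : 'M[R]_(n, r)),
    compact_svd (M k t w) U s V /\ direction k t w = U *m V^T.
Proof.
move=> tT; have [r [U [s [V [svd E]]]]] := Wt_step run k w tT.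
exists r, U, s, V; split=> //.
by rewrite /direction E opprB addrC subrK scalerA mulVf ?scale1r // gt_eqF.
Qed.

Lemma Wt_direction k t w : Wt k t.+1 w = W k t w - eta *: direction k t w.
Proof. by rewrite scalerA divff ?scale1r ?opprB ?subKr // ?gt_eqF // addrC subrK. Qed.

Lemma frob_direction k t w : (t < T)%N -> frob (direction k t w) <= sn.
Proof.
by move=> /(directionP k w)[r [U [s [V [[UU VV _ _] ->]]]]]; exact: svd_frob_polar.
Qed.

Lemma frob_local_step k t w : (t < T)%N ->
  frob (Wt k t.+1 w - W k t w) <= eta * sn.
Proof.
move=> tT; rewrite Wt_direction addrAC subrr add0r frobN frobZ gtr0_norm //.
by rewrite ler_pM2l // frob_direction.
Qed.

(* Between two communication rounds the clients drift away from a common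
   anchor by at most one step length per iteration. *)
Lemma local_drift t w : (t <= T)%N ->
  exists A, forall k, frob (W k t w - A) <= eta * sn * (t %% tau)%:R.
Proof.
elim: t => [_|t IH tT].
  by exists W0 => k; rewrite (W_init run) subrr frob0 mod0n mulr0.
have [A HA] := IH (ltnW tT); rewrite modnS.
case: ifP => dt.
  exists (average (fun j => Wt j t.+1 w)) => k.
  by rewrite (W_step run) // dt subrr frob0 mulr0.
exists A => k; rewrite (W_step run) // dt.
rewrite (le_trans (frob_dist_triangle (W k t w) _ _)) //.
rewrite -natr1 mulrDr mulr1 addrC lerD // ?frob_local_step //.
Qed.

Lemma consensus t w k : (t < T)%N -> frob (Wt k t.+1 w - Wbar t.+1 w) <= rho.
Proof.
move=> tT; have [A HA] := local_drift w (ltnW tT).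
have HWt j : frob (Wt j t.+1 w - A) <= eta * sn * tau%:R.
  rewrite (le_trans (frob_dist_triangle (W j t w) _ _)) //.
  rewrite (le_trans (lerD (frob_local_step j w tT) (HA j))) //.
  (* The t mod tau steps since the last communication and the current one are at most tau in
     number. *)
  rewrite -[X in X + _]mulr1 -mulrDr ler_wpM2l // nat1r ler_nat.
  by rewrite ltn_mod.
rewrite (le_trans (frob_dist_triangle A _ _)) // /rho mulr_natl mulr2n lerD //.
rewrite Wbar_succ // frob_distC -{1}(average_const A K0) -averageN -averageD.
exact: frob_average_le.
Qed.

Lemma query_consensus t w k : (t <= T)%N -> frob (query k t w - Wbar t w) <= rho.
Proof.
case: t => [_|t tT] /=; first by rewrite Wbar0 subrr frob0 consensus_radius_ge0.
exact: consensus.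
Qed.

Lemma Wbar_step t w : (t < T)%N ->
  Wbar t.+1 w = - (eta *: average (fun k => direction k t w)) + Wbar t w.
Proof.
move=> tT; rewrite Wbar_succ // (_ : (fun k => Wt k t.+1 w) =
    (fun k => W k t w - eta *: direction k t w)).
  by rewrite averageD averageN averageZ addrC.
by apply/funext => k; rewrite Wt_direction.
Qed.

Lemma frob_Wbar_step t w : (t < T)%N -> frob (Wbar t.+1 w - Wbar t w) <= eta * sn.
Proof.
move=> tT; rewrite Wbar_step // addrK frobN frobZ gtr0_norm // ler_pM2l //.
by apply: frob_average_le => // k; exact: frob_direction.
Qed.

(** The bias contracts by 1 - alpha, pays for the motion of the target at [Wbar], and pays alpha
    times the query gap. It vanishes at time 0, where u is the exact value plus its noise. *)
Lemma u_decomposition k t w : (t <= T)%N ->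
  frob (u k t w - inner_mean (cl k) (Wbar t w) - u_noise k t w) <= u_drift.
Proof.
have lg := inner_mean_lipschitz Cg0 (reg k) (unb k) (var k) (mom k).
elim: t => [_|t IH tT].
  rewrite u_at0 Wbar0 /= /inner_noise /= subrr frob0; exact: u_drift_ge0.
have {}IH := IH (ltnW tT); rewrite u_succ //=.
set g := inner_mean (cl k) in lg *.
have -> : alpha *: inner (cl k) (query k t.+1 w) (xi k t.+1 w) +
    (1 - alpha) *: u k t w - g (Wbar t.+1 w) -
    ((1 - alpha) *: u_noise k t w + alpha *: inner_noise k t.+1 w) =
    (1 - alpha) *: ((u k t w - g (Wbar t w) - u_noise k t w) -
       (g (Wbar t.+1 w) - g (Wbar t w))) +
    alpha *: (g (query k t.+1 w) - g (Wbar t.+1 w)).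
  by apply/matrixP => i j; rewrite /inner_noise -/g !mxE; ring.
rewrite (le_trans (frobD _ _)) // !frobZ !ger0_norm ?subr_ge0 ?(ltW alpha_gt0) //.
have B1 := le_trans (lg (Wbar t.+1 w) (Wbar t w))
  (ler_wpM2l (ltW Cg0) (frob_Wbar_step w tT)).
have B2 := le_trans (lg (query k t.+1 w) (Wbar t.+1 w))
  (ler_wpM2l (ltW Cg0) (query_consensus w k tT)).
have B3 := le_trans (frobB _ _) (lerD IH B1).
have a1 : 0 <= 1 - alpha by rewrite subr_ge0.
rewrite (le_trans (lerD (ler_wpM2l a1 B3) (ler_wpM2l (ltW alpha_gt0) B2))) //.
(* [u_drift] is chosen for this balance; the induction closes with slack alpha times the motion
   term. *)
have E : alpha * u_drift = Cg * (eta * sn) + alpha * (Cg * rho).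
  by rewrite /u_drift; field; rewrite gt_eqF.
have : 0 <= alpha * (Cg * (eta * sn)).
  by rewrite !mulr_ge0 // ltW.
rewrite mulrDr -subr_ge0 => h; rewrite -subr_ge0.
have -> : u_drift - ((1 - alpha) * u_drift + (1 - alpha) * (Cg * (eta * sn)) +
   alpha * (Cg * rho)) = alpha * u_drift - Cg * (eta * sn) - alpha * (Cg * rho)
     + alpha * (Cg * (eta * sn)) by ring.
by rewrite E; move: h; rewrite subr0; lra.
Qed.

Lemma u_error k t w : (t <= T)%N ->
  frob (u k t w - inner_mean (cl k) (query k t w)) <=
    u_drift + Cg * rho + frob (u_noise k t w).
Proof.
move=> tT; have lg := inner_mean_lipschitz Cg0 (reg k) (unb k) (var k) (mom k).
set g := inner_mean (cl k) in lg *.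
have -> : u k t w - g (query k t w) = (u k t w - g (Wbar t w) - u_noise k t w)
    - (g (query k t w) - g (Wbar t w)) + u_noise k t w.
  by apply/matrixP => i j; rewrite !mxE; ring.
rewrite (le_trans (frobD _ _)) // lerD // (le_trans (frobB _ _)) // lerD //.
  exact: u_decomposition.
by rewrite (le_trans (lg _ _)) // ler_wpM2l ?(ltW Cg0) // query_consensus.
Qed.

(** Subtracting the averaged noise leaves an error that obeys a recursion outcome by outcome;
    independence is used only later, in the moment bounds. *)
Definition M_bias t w :=
  Mbar t w - grad (objective cl) (Wbar t w) - average (fun k => M_noise k t w).

(** [M_noise] starts at 0, so the whole initial momentum counts as bias. *)
Lemma M_bias0 w : frob (M_bias 0 w) <=
  K%:R^-1 * (\sum_k frob (sampled_grad k 0 w)) + Cg * Cf.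
Proof.
rewrite /M_bias /= average_const // subr0 (le_trans (frobB _ _)) // lerD //.
  rewrite (le_trans (frob_average _)) // ler_wpM2l ?invr_ge0 //.
  by apply: ler_sum => k _; rewrite M_at0.
rewrite (grad_objective dcl); apply: frob_average_le => // k.
exact: (@frob_grad_client_obj _ _ _ _ (cl k) sg sdg sf).
Qed.

(** The sampled gradient splits into the two noises, the exact client gradient at the query point,
    and the term [B] caused by using u in place of the exact inner value. Only [B] and the gap [F]
    between query point and [Wbar] create new bias of weight beta. *)
Lemma M_bias_succ t w : (t < T)%N ->
  frob (M_bias t.+1 w) <= (1 - beta) * (frob (M_bias t w) + L * (eta * sn)) +
    beta * (K%:R^-1 * (\sum_k frob (sampled_jac k t.+1 w) *
      (`|Lf| * (u_drift + Cg * rho + frob (u_noise k t.+1 w)))) + L * rho).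
Proof.
move=> tT; rewrite /M_bias Mbar_succ // (grad_objective dcl).
pose B k := sampled_jac k t.+1 w *m
  kron_id n (grad (outer_mean (cl k)) (u k t.+1 w) - query_grad k t.+1 w).
pose F k := grad (client_obj (cl k)) (query k t.+1 w) -
  grad (client_obj (cl k)) (Wbar t.+1 w).
have EG k : beta *: sampled_grad k t.+1 w + (1 - beta) *: M k t w -
    grad (client_obj (cl k)) (Wbar t.+1 w) - M_noise k t.+1 w =
    (1 - beta) *: (M k t w - grad (client_obj (cl k)) (Wbar t w) - M_noise k t w
      - (grad (client_obj (cl k)) (Wbar t.+1 w) -
         grad (client_obj (cl k)) (Wbar t w)))
    + beta *: (B k + F k).
  have -> : B k + F k = sampled_grad k t.+1 w - outer_noise k t.+1 w
      - jac_noise k t.+1 w - grad (client_obj (cl k)) (Wbar t.+1 w).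
    rewrite /F (grad_client_obj (reg k) (query k t.+1 w)).
    rewrite /B /outer_noise /jac_noise /sampled_grad /query_grad !kron_idB.
    rewrite mulmxBl !mulmxBr.
    by apply/matrixP => i j; rewrite !mxE; ring.
  rewrite /=; apply/matrixP => i j; rewrite !mxE; ring.
have -> : average (fun k => Mt k t.+1 w) -
    average (fun k => grad (client_obj (cl k)) (Wbar t.+1 w)) -
    average (fun k => M_noise k t.+1 w) =
    average (fun k => (1 - beta) *:
      (M k t w - grad (client_obj (cl k)) (Wbar t w) - M_noise k t w
      - (grad (client_obj (cl k)) (Wbar t.+1 w) -
         grad (client_obj (cl k)) (Wbar t w)))
    + beta *: (B k + F k)).
  rewrite -(funext EG) (averageB _ (fun k => M_noise k t.+1 w)).
  rewrite (averageB (fun k => beta *: sampled_grad k t.+1 w + (1 - beta) *: M k t w)).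
  by congr (average _ - _ - _); apply/funext => k; rewrite Mt_succ.
rewrite averageD !averageZ (le_trans (frobD _ _)) // (frobZ (1 - beta)) (frobZ beta).
rewrite (ger0_norm (ltW beta_gt0)) ger0_norm ?subr_ge0 // lerD //.
  rewrite ler_wpM2l ?subr_ge0 // averageD (le_trans (frobD _ _)) // lerD //.
    by rewrite averageD averageD !averageN -/(Mbar t w) -(grad_objective dcl).
  rewrite averageN frobN averageD averageN -!(grad_objective dcl).
  rewrite (le_trans (grad_objective_lipschitz K0 dcl lcl _ _)) // ler_wpM2l //.
  exact: frob_Wbar_step.
rewrite ler_wpM2l ?(ltW beta_gt0) // averageD (le_trans (frobD _ _)) // lerD //.
  rewrite (le_trans (frob_average _)) // ler_wpM2l ?invr_ge0 // ler_sum // => k _.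
  rewrite (le_trans (frob_mul_kron_id _ _)) // ler_wpM2l ?frob_ge0 //.
  rewrite (le_trans (grad_outer_mean_lipschitz (smo k) _ _)) // ler_wpM2l //.
  exact: u_error.
apply: frob_average_le => // k; rewrite (le_trans (lcl _ _ _)) // ler_wpM2l //.
exact: query_consensus.
Qed.

Definition M_spread t w := \sum_k frob (M k t w - Mbar t w).

Lemma sum_frob_sub_average (f : 'I_K -> 'M[R]_(m, n)) :
  \sum_k frob (f k - average f) <= 2 * \sum_k frob (f k).
Proof.
rewrite mulr_natl mulr2n.
rewrite (le_trans (ler_sum _ (fun k _ => frobB (f k) (average f)))) //.
rewrite big_split lerD //= sumr_const card_ord -mulr_natl.
by rewrite -ler_pdivlMl ?ltr0n // frob_average.
Qed.

Lemma M_spread0 w : M_spread 0 w <= 2 * \sum_k frob (sampled_grad k 0 w).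
Proof.
rewrite /M_spread /Mbar (_ : (fun k => M k 0 w) = (fun k => sampled_grad k 0 w)).
  under eq_bigr do rewrite M_at0.
  exact: sum_frob_sub_average.
by apply/funext => k; rewrite M_at0.
Qed.

(** Communication makes all momenta equal. Otherwise the old deviations do not grow, and the new
    gradients add beta times their own spread. *)
Lemma M_spread_succ t w : (t < T)%N -> M_spread t.+1 w <=
  if (tau %| t.+1)%N then 0
  else M_spread t w + 2 * (beta * \sum_k frob (sampled_grad k t.+1 w)).
Proof.
move=> tT; case: ifP => dt.
  rewrite /M_spread big1 // => k _.
  by rewrite Mbar_succ // (M_step run) // dt subrr frob0.
pose f k := sampled_grad k t.+1 w.
have -> : M_spread t.+1 w = \sum_k frob ((1 - beta) *: (M k t w - Mbar t w) +
    beta *: (f k - average f)).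
  apply: eq_bigr => k _; rewrite Mbar_succ // (M_step run) // dt Mt_succ //.
  rewrite (_ : (fun k => Mt k t.+1 w) = (fun k => beta *: f k + (1 - beta) *: M k t w)).
    rewrite averageD !averageZ -/(Mbar t w) -/(f k); congr frob.
    by apply/matrixP => i j; rewrite !mxE; ring.
  by apply/funext => j; rewrite Mt_succ.
rewrite (le_trans (ler_sum _ (fun k _ => frobD _ _))) // big_split lerD //=.
  apply: ler_sum => k _; rewrite frobZ ger0_norm ?subr_ge0 //.
  by rewrite ler_piMl ?frob_ge0 // gerBl ltW.
under eq_bigr do rewrite frobZ gtr0_norm //.
by rewrite -mulr_sumr mulrCA ler_pM2l // sum_frob_sub_average.
Qed.

(** The descent lemma along the averaged direction, the error of each client momentum being split
    into bias, noise and spread. *)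
Lemma descent_step t w : (t < T)%N ->
  eta * frob (grad (objective cl) (Wbar t w)) <=
    objective cl (Wbar t w) - objective cl (Wbar t.+1 w) +
    eta * ((1 + sn) * (frob (M_bias t w) +
       K%:R^-1 * (\sum_k frob (M_noise k t w)) + K%:R^-1 * M_spread t w))
    + L * eta ^+ 2 * n%:R.
Proof.
move=> tT; set g := grad (objective cl) (Wbar t w).
(* With O the direction, <M, O> >= |M| >= |g| - |M - g| and <M - g, O> <= sn |M - g|; the two losses
   give the factor 1 + sn. *)
have dg k : frob g - (1 + sn) * frob (M k t w - g) <= mxdot g (direction k t w).
  have [r [U [s [V [svd E]]]]] := directionP k w tT.
  have lo := svd_dot_polar svd; rewrite -E in lo.
  have up := mxdot_le_frob (M k t w - g) (direction k t w).
  have up' := ler_wpM2l (frob_ge0 (M k t w - g)) (frob_direction k w tT).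
  have tri := frobB (M k t w) (M k t w - g); rewrite subKr in tri.
  move: up; rewrite mxdotDl mxdotNl; move: lo up' tri.
  move: (frob (M k t w)) (frob (M k t w - g)) (frob g) (mxdot g _) (mxdot _ _)
    => a b c e f; move: (frob (direction k t w)) => o; move: (Num.sqrt _) => q.
  lra.
have Hb : K%:R^-1 * \sum_k frob (M k t w - g) <= frob (M_bias t w) +
    K%:R^-1 * (\sum_k frob (M_noise k t w)) + K%:R^-1 * M_spread t w.
  set c := frob (M_bias t w) + _.
  have Hk k : frob (M k t w - g) <= c + frob (M k t w - Mbar t w).
    rewrite (_ : M k t w - g = M_bias t w + average (fun k => M_noise k t w) +
        (M k t w - Mbar t w)); last first.
      by apply/matrixP => i j; rewrite /M_bias /g !mxE; ring.
    rewrite (le_trans (frobD _ _)) // lerD // (le_trans (frobD _ _)) // lerD //.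
    exact: frob_average.
  rewrite -[X in X + _](mean_const c K0) -mulrDr ler_wpM2l ?invr_ge0 //.
  by rewrite -big_split; apply: ler_sum => k _; exact: Hk.
have := descent_lemma (Wbar t w) (- (eta *: average (fun k => direction k t w)))
  L0 (objective_differentiable dcl) (grad_objective_lipschitz K0 dcl lcl).
rewrite -Wbar_step // mxdotNr mxdotZr frobN -/g.
have En : L * frob (eta *: average (fun k => direction k t w)) ^+ 2 <= L * eta ^+ 2 * n%:R.
  rewrite -mulrA ler_wpM2l // frobZ gtr0_norm // exprMn ler_wpM2l ?sqr_ge0 //.
  rewrite -[leRHS](sqr_sqrtr (ler0n R n)) ler_pXn2r ?nnegrE ?frob_ge0 //.
  by apply: frob_average_le => // k; exact: frob_direction.
have Eg : frob g - (1 + sn) * (K%:R^-1 * \sum_k frob (M k t w - g)) <=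
    mxdot g (average (fun k => direction k t w)).
  rewrite mxdotZr mxdot_sumr -[X in X - _](mean_const (frob g) K0) mulrCA -mulrBr.
  rewrite ler_wpM2l ?invr_ge0 // mulr_sumr -sumrB.
  by apply: ler_sum => k _; exact: dg.
move=> D; have sn1 : 0 <= 1 + sn by rewrite addr_ge0.
have H1 := ler_wpM2l (ltW eta0) Eg; rewrite mulrBr in H1.
have H2 := ler_wpM2l (ltW eta0) (ler_wpM2l sn1 Hb).
have := le_trans D (lerD (lexx _) En).
move: H1 H2; set x1 := eta * frob g; set x2 := eta * ((1 + sn) * _).
set x3 := eta * mxdot g _; set x4 := eta * ((1 + sn) * _).
move: x1 x2 x3 x4 => x1 x2 x3 x4; lra.
Qed.

(** * Measurability of the iterates in the samples drawn so far *)

Section Filtration.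
Context {dS : measure_display} {S : measurableType dS}.
(** [phi] will be the identity of the sample space or the projection from the product of the past
    with the law of a fresh sample; the samples before [t0] are those known to be measurable. *)
Variables (phi : S -> Omega) (t0 : nat).
Hypothesis mxi : forall k s, (s < t0)%N -> (s <= T)%N ->
  measurable_fun [set: S] (fun x => xi k s (phi x)).
Hypothesis mzeta : forall k s, (s < t0)%N -> (s <= T)%N ->
  measurable_fun [set: S] (fun x => zeta k s (phi x)).

Lemma eq_measurable_mx (p q : nat) (A B : S -> 'M[R]_(p, q)) :
  A =1 B -> measurable_mx B -> measurable_mx A.
Proof. by move=> /funext ->. Qed.

Let measurable_query_succ k t : (t < T)%N ->
  measurable_mx (fun x => W k t (phi x)) ->
  measurable_mx (fun x => M k t (phi x)) ->
  measurable_mx (fun x => query k t.+1 (phi x)).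
Proof.
move=> tT mW mM.
apply: (@eq_measurable_mx _ _ _
  (fun x => W k t (phi x) - eta *: direction k t (phi x))) => [x|].
  exact: Wt_direction.
apply: measurable_mxB => //; apply: measurable_mxZl.
by apply: (measurable_polar mM) => x; exact: directionP.
Qed.

Let measurable_u_step k t : (t <= T)%N ->
  measurable_mx (fun x => query k t (phi x)) ->
  (forall s, t = s.+1 -> measurable_mx (fun x => u k s (phi x))) ->
  measurable_fun [set: S] (fun x => xi k t (phi x)) ->
  measurable_mx (fun x => u k t (phi x)).
Proof.
case: t => [_ mq _ mx|t tT mq /(_ _ erefl) mu mx].
  apply: (@eq_measurable_mx _ _ _ (fun x => inner (cl k) (query k 0 (phi x))
    (xi k 0%N (phi x)))) => [x|]; first exact: u_at0.
  exact: measurable_inner.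
apply: (@eq_measurable_mx _ _ _ (fun x =>
  alpha *: inner (cl k) (query k t.+1 (phi x)) (xi k t.+1 (phi x)) +
  (1 - alpha) *: u k t (phi x))) => [x|]; first exact: u_succ.
apply: measurable_mxD; apply: measurable_mxZl => //.
exact: measurable_inner.
Qed.

Let measurable_sampled_grad_step k t :
  measurable_mx (fun x => query k t (phi x)) ->
  measurable_mx (fun x => u k t (phi x)) ->
  measurable_fun [set: S] (fun x => xi k t (phi x)) ->
  measurable_fun [set: S] (fun x => zeta k t (phi x)) ->
  measurable_mx (fun x => sampled_grad k t (phi x)).
Proof.
move=> mq mu mx mz; apply: measurable_mxM; first exact: measurable_inner_jac.
by apply: measurable_kron_id; exact: measurable_outer_grad.
Qed.

Let measurable_iterates t : (t < t0)%N -> (t <= T)%N -> forall k,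
  [/\ measurable_mx (fun x => query k t (phi x)),
      measurable_mx (fun x => u k t (phi x)),
      measurable_mx (fun x => W k t (phi x))
    & measurable_mx (fun x => M k t (phi x))].
Proof.
elim: t => [|t IH] tt0 tT k.
  have mq : measurable_mx (fun x => query k 0 (phi x)) by exact: measurable_mx_cst.
  have mu : measurable_mx (fun x => u k 0 (phi x)).
    by apply: measurable_u_step => //; exact: mxi.
  split=> //.
    apply: (@eq_measurable_mx _ _ _ (fun=> W0)) => [x|]; first exact: (W_init run).
    exact: measurable_mx_cst.
  apply: (@eq_measurable_mx _ _ _ (fun x => sampled_grad k 0 (phi x))) => [x|].
    exact: M_at0.
  by apply: measurable_sampled_grad_step => //; [exact: mxi|exact: mzeta].
have {}IH := IH (ltnW tt0) (ltnW tT).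
have mq j : measurable_mx (fun x => query j t.+1 (phi x)).
  by have [_ _ mW mM] := IH j; exact: measurable_query_succ.
have mu j : measurable_mx (fun x => u j t.+1 (phi x)).
  apply: measurable_u_step => //; last exact: mxi.
  by move=> s [<-]; have [] := IH j.
have mMt j : measurable_mx (fun x => Mt j t.+1 (phi x)).
  apply: (@eq_measurable_mx _ _ _ (fun x => beta *: sampled_grad j t.+1 (phi x) +
    (1 - beta) *: M j t (phi x))) => [x|]; first exact: Mt_succ.
  apply: measurable_mxD; apply: measurable_mxZl; last by have [] := IH j.
  by apply: measurable_sampled_grad_step => //; [exact: mxi|exact: mzeta].
have EW x := W_step run k (phi x) tT; have EM x := M_step run k (phi x) tT.
have [dt|/negPf dt] := boolP (tau %| t.+1)%N; rewrite dt in EW EM.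
  by split=> //; [rewrite (funext EW)|rewrite (funext EM)]; exact: measurable_average.
by split=> //; [rewrite (funext EW); exact: mq|rewrite (funext EM); exact: mMt].
Qed.

(** The query point at time t uses only samples drawn before t, whence the weak inequality with
    [t0]; W and M also use those of time t. *)
Lemma measurable_query k t : (t <= t0)%N -> (t <= T)%N ->
  measurable_mx (fun x => query k t (phi x)).
Proof.
case: t => [_ _|t tt0 tT]; first exact: measurable_mx_cst.
by have [_ _ mW mM] := measurable_iterates tt0 (ltnW tT) k; exact: measurable_query_succ.
Qed.

Lemma measurable_W k t : (t < t0)%N -> (t <= T)%N ->
  measurable_mx (fun x => W k t (phi x)).
Proof. by move=> tt0 tT; have [] := measurable_iterates tt0 tT k. Qed.

Lemma measurable_M k t : (t < t0)%N -> (t <= T)%N ->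
  measurable_mx (fun x => M k t (phi x)).
Proof. by move=> tt0 tT; have [] := measurable_iterates tt0 tT k. Qed.

(** Beyond the past, u_t uses xi_t but not zeta_t, so zeta_t can still be treated as fresh once u_t
    is known. *)
Lemma measurable_u k t : (t <= t0)%N -> (t <= T)%N ->
  measurable_fun [set: S] (fun x => xi k t (phi x)) ->
  measurable_mx (fun x => u k t (phi x)).
Proof.
move=> tt0 tT mx; apply: measurable_u_step => //; first exact: measurable_query.
by move=> s ts; rewrite ts in tt0 tT; have [] := measurable_iterates tt0 (ltnW tT) k.
Qed.

Lemma measurable_sampled_jac k t : (t <= t0)%N -> (t <= T)%N ->
  measurable_fun [set: S] (fun x => xi k t (phi x)) ->
  measurable_mx (fun x => sampled_jac k t (phi x)).
Proof. by move=> tt0 tT mx; apply: measurable_inner_jac => //; exact: measurable_query. Qed.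

Lemma measurable_sampled_grad k t : (t < t0)%N -> (t <= T)%N ->
  measurable_mx (fun x => sampled_grad k t (phi x)).
Proof.
move=> tt0 tT; apply: measurable_sampled_grad_step.
- exact: measurable_query (ltnW tt0) tT.
- by apply: measurable_u => //; [exact: ltnW|exact: mxi].
- exact: mxi.
- exact: mzeta.
Qed.

Lemma measurable_query_grad k t : (t <= t0)%N -> (t <= T)%N ->
  measurable_mx (fun x => query_grad k t (phi x)).
Proof.
move=> tt0 tT; apply: measurable_grad_outer_mean => //.
by apply: measurable_inner_mean => //; exact: measurable_query.
Qed.

Lemma measurable_inner_noise k t : (t <= t0)%N -> (t <= T)%N ->
  measurable_fun [set: S] (fun x => xi k t (phi x)) ->
  measurable_mx (fun x => inner_noise k t (phi x)).
Proof.
move=> tt0 tT mx; have mq := measurable_query k tt0 tT.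
by apply: measurable_mxB; [exact: measurable_inner|exact: measurable_inner_mean].
Qed.

Lemma measurable_jac_noise k t : (t <= t0)%N -> (t <= T)%N ->
  measurable_fun [set: S] (fun x => xi k t (phi x)) ->
  measurable_mx (fun x => jac_noise k t (phi x)).
Proof.
move=> tt0 tT mx; apply: measurable_mxM; last first.
  by apply: measurable_kron_id; exact: measurable_query_grad.
apply: measurable_mxB; first exact: measurable_sampled_jac.
by apply: measurable_jac_inner_mean => //; exact: measurable_query.
Qed.

Lemma measurable_outer_noise k t : (t < t0)%N -> (t <= T)%N ->
  measurable_mx (fun x => outer_noise k t (phi x)).
Proof.
move=> tt0 tT; apply: measurable_mxM.
  by apply: measurable_sampled_jac => //; [exact: ltnW|exact: mxi].
have mu : measurable_mx (fun x => u k t (phi x)).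
  by apply: measurable_u => //; [exact: ltnW|exact: mxi].
apply: measurable_kron_id; apply: measurable_mxB.
  by apply: measurable_outer_grad => //; exact: mzeta.
exact: measurable_grad_outer_mean.
Qed.

Lemma measurable_u_noise k t : (t < t0)%N -> (t <= T)%N ->
  measurable_mx (fun x => u_noise k t (phi x)).
Proof.
elim: t => [|t IH] tt0 tT /=.
  by apply: measurable_inner_noise => //; exact: mxi.
apply: measurable_mxD; apply: measurable_mxZl; first exact: IH (ltnW tt0) (ltnW tT).
by apply: measurable_inner_noise => //; [exact: ltnW|exact: mxi].
Qed.

Lemma measurable_M_noise k t : (t < t0)%N -> (t <= T)%N ->
  measurable_mx (fun x => M_noise k t (phi x)).
Proof.
elim: t => [|t IH] tt0 tT /=; first exact: measurable_mx_cst.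
apply: measurable_mxD; last by apply: measurable_mxZl; exact: measurable_outer_noise.
apply: measurable_mxD; apply: measurable_mxZl; first exact: IH (ltnW tt0) (ltnW tT).
by apply: measurable_jac_noise => //; [exact: ltnW|exact: mxi].
Qed.

End Filtration.

(** * Integrating out one fresh sample of the run *)

Section Samples.

Local Notation events := (@sample_events R K m n d cl dO Omega P xi zeta T).

Lemma sample_events_measurable i : events i `<=` measurable.
Proof.
by case: i => [[k t] []] B /= [C mC <-]; [apply: (@measurable_funP _ _ _ _ _ (xi k t))
  |apply: (@measurable_funP _ _ _ _ _ (zeta k t))].
Qed.

Lemma sample_events_setT i : events i setT.
Proof. by case: i => [[k t] []]; exists setT => //; rewrite setTI. Qed.

Lemma sample_events_setI i : setI_closed (events i).
Proof.
by case: i => [[k t] []] _ _ [C mC <-] [D mD <-]; exists (C `&` D);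
  rewrite ?setTI ?preimage_setI //; exact: measurableI.
Qed.

Local Notation past i := (g_sigma_algebraType (others events i)).

Lemma sub_past i j B : j != i -> events j B -> (measurable : set (set (past i))) B.
Proof.
move=> ji Bj; apply: sub_sigma_algebra.
exact: (sub_others sample_events_setT ji).
Qed.

Lemma measurable_past_xi i k s : (s <= T)%N -> (k, inord s, true) != i ->
  measurable_fun [set: past i] (fun x : past i => xi k s x).
Proof.
move=> sT ki _ B mB; apply: (sub_past ki) => /=.
by rewrite inordK // setTI; exists B => //; rewrite setTI.
Qed.

Lemma measurable_past_zeta i k s : (s <= T)%N -> (k, inord s, false) != i ->
  measurable_fun [set: past i] (fun x : past i => zeta k s x).
Proof.
move=> sT ki _ B mB; apply: (sub_past ki) => /=.
by rewrite inordK // setTI; exists B => //; rewrite setTI.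
Qed.

Lemma mean_bounded_fresh_xi k t (psi : Omega -> inner_space (cl k) -> R) c b :
  (t <= T)%N ->
  measurable_fun [set: past (k, inord t, true) * inner_space (cl k)]
    (fun z => psi z.1 z.2) ->
  (forall w v, 0 <= psi w v) ->
  (forall w, (\int[inner_law (cl k)]_v (psi w v)%:E <= (c w)%:E)%E) ->
  mean_bounded P c b ->
  mean_bounded P (fun w => psi w (xi k t w)) b.
Proof.
move=> tT; apply: mean_bounded_fresh.
- exact: sample_events_measurable.
- exact: sample_events_setT.
- exact: sample_events_setI.
- exact: (samples_independent fresh).
- by rewrite /= inordK.
- by move=> A mA; exact: (xi_law fresh).
Qed.

Lemma mean_bounded_fresh_zeta k t (psi : Omega -> outer_space (cl k) -> R) c b :
  (t <= T)%N ->
  measurable_fun [set: past (k, inord t, false) * outer_space (cl k)]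
    (fun z => psi z.1 z.2) ->
  (forall w v, 0 <= psi w v) ->
  (forall w, (\int[outer_law (cl k)]_v (psi w v)%:E <= (c w)%:E)%E) ->
  mean_bounded P c b ->
  mean_bounded P (fun w => psi w (zeta k t w)) b.
Proof.
move=> tT; apply: mean_bounded_fresh.
- exact: sample_events_measurable.
- exact: sample_events_setT.
- exact: sample_events_setI.
- exact: (samples_independent fresh).
- by rewrite /= inordK.
- by move=> A mA; exact: (zeta_law fresh).
Qed.

End Samples.

(** * Second moments of the noises *)

Section Moments.

Local Notation events := (@sample_events R K m n d cl dO Omega P xi zeta T).
Local Notation past i := (g_sigma_algebraType (others events i)).

Let inord_neq (s t : nat) : (s < t)%N -> (t <= T)%N -> inord s != inord t :> 'I_T.+1.
Proof.
move=> st tT; apply: contraTneq st => E.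
have : (inord s : 'I_T.+1) = t :> nat by rewrite E inordK.
by case: (ltnP s T.+1) => sT; [rewrite inordK // => ->; rewrite ltnn|
  move=> _; rewrite -leqNgt (leq_trans tT) // ltnW].
Qed.

Section FreshXi.
Variables (k : 'I_K) (t : nat).
Hypothesis tT : (t <= T)%N.
Local Notation S := (past (k, inord t, true) * inner_space (cl k))%type.

Lemma measurable_fresh_xi_xi j s : (s < t)%N -> (s <= T)%N ->
  measurable_fun [set: S] (fun z : S => xi j s z.1).
Proof.
move=> st sT.
apply: (measurableT_comp (measurable_past_xi sT _) measurable_fst).
by rewrite !xpair_eqE (negPf (inord_neq st tT)) andbF.
Qed.

Lemma measurable_fresh_xi_zeta j s : (s < t)%N -> (s <= T)%N ->
  measurable_fun [set: S] (fun z : S => zeta j s z.1).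
Proof.
move=> st sT.
apply: (measurableT_comp (measurable_past_zeta sT _) measurable_fst).
by rewrite !xpair_eqE andbF.
Qed.

Lemma measurable_fresh_query j :
  measurable_mx (fun z : S => query j t z.1).
Proof.
exact: (@measurable_query _ _ (fun z : S => z.1 : Omega) t
  measurable_fresh_xi_xi measurable_fresh_xi_zeta).
Qed.

End FreshXi.

Section FreshZeta.
Variables (k : 'I_K) (t : nat).
Hypothesis tT : (t <= T)%N.
Local Notation S := (past (k, inord t, false) * outer_space (cl k))%type.

(** The case s = t is included: xi_t is tagged differently from zeta_t and belongs to the other
    samples. *)
Lemma measurable_fresh_zeta_xi j s : (s <= T)%N ->
  measurable_fun [set: S] (fun z : S => xi j s z.1).
Proof.
move=> sT.
apply: (measurableT_comp (measurable_past_xi sT _) measurable_fst).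
by rewrite !xpair_eqE andbF.
Qed.

Lemma measurable_fresh_zeta_zeta j s : (s < t)%N -> (s <= T)%N ->
  measurable_fun [set: S] (fun z : S => zeta j s z.1).
Proof.
move=> st sT.
apply: (measurableT_comp (measurable_past_zeta sT _) measurable_fst).
by rewrite !xpair_eqE (negPf (inord_neq st tT)) andbF.
Qed.

End FreshZeta.

Let mid_xi k s : (s < T.+1)%N -> (s <= T)%N ->
  measurable_fun [set: Omega] (fun w => xi k s (id w)).
Proof. by move=> _ _; exact: measurable_funPT (xi k s). Qed.

Let mid_zeta k s : (s < T.+1)%N -> (s <= T)%N ->
  measurable_fun [set: Omega] (fun w => zeta k s (id w)).
Proof. by move=> _ _; exact: measurable_funPT (zeta k s). Qed.

Lemma mean_bounded_sampled_jac k t : (t <= T)%N ->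
  mean_bounded P (fun w => frob (sampled_jac k t w) ^+ 2) (Cg ^+ 2).
Proof.
move=> tT.
apply: (@mean_bounded_fresh_xi k t (fun w v => frob (inner_jac v (query k t w)) ^+ 2)
  (fun=> Cg ^+ 2)) => //.
- apply: measurable_funX; apply: measurable_frob.
  by apply: measurable_inner_jac => //; exact: measurable_fresh_query.
- by move=> w v; exact: sqr_ge0.
- by move=> w; exact: integral_sqr_inner_jac (mom k) _.
- by apply: mean_bounded_cst; exact: sqr_ge0.
Qed.

Lemma mean_bounded_sampled_outer_grad k t : (t <= T)%N ->
  mean_bounded P (fun w => frob (outer_grad (zeta k t w) (u k t w)) ^+ 2) (Cf ^+ 2).
Proof.
move=> tT.
apply: (@mean_bounded_fresh_zeta k t (fun w v => frob (outer_grad v (u k t w)) ^+ 2)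
  (fun=> Cf ^+ 2)) => //.
- apply: measurable_funX; apply: measurable_frob.
  apply: measurable_outer_grad => //.
  apply: (@measurable_u _ _
    (fun z : past (k, inord t, false) * outer_space (cl k) => z.1 : Omega) t) => //.
  + by move=> j s _; exact: measurable_fresh_zeta_xi.
  + exact: measurable_fresh_zeta_zeta.
  + exact: measurable_fresh_zeta_xi.
- by move=> w v; exact: sqr_ge0.
- by move=> w; exact: integral_sqr_outer_grad (mom k) _.
- by apply: mean_bounded_cst; exact: sqr_ge0.
Qed.

(** Bounds the mean of a product of two norms by the arithmetic-geometric inequality, from the
    second moments of the factors. *)
Definition grad_bound : R := (Cg ^+ 2 + Cf ^+ 2) / 2.

Lemma mean_bounded_sampled_grad k t : (t <= T)%N ->
  mean_bounded P (fun w => frob (sampled_grad k t w)) grad_bound.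
Proof.
move=> tT.
have H : mean_bounded P (fun w => 2^-1 * (frob (sampled_jac k t w) ^+ 2 +
    frob (outer_grad (zeta k t w) (u k t w)) ^+ 2)) grad_bound.
  rewrite /grad_bound mulrC; apply: mean_boundedZ => //.
  by apply: mean_boundedD; [exact: mean_bounded_sampled_jac|
    exact: mean_bounded_sampled_outer_grad].
apply: mean_bounded_le H.
  by apply: measurable_frob; exact: (measurable_sampled_grad mid_xi mid_zeta).
move=> w; rewrite frob_ge0 /= (le_trans (frob_mul_kron_id _ _)) //.
have := sqr_ge0 (frob (sampled_jac k t w) - frob (outer_grad (zeta k t w) (u k t w))).
by rewrite sqrrB; lra.
Qed.

(** By orthogonality the second moment v satisfies v_{t+1} <= (1 - alpha)^2 v_t + alpha^2 sg^2. With
    the first square relaxed to 1 - alpha, alpha sg^2 is stationary; the geometric term remembers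
    that u_0 is a raw sample. *)
Lemma mean_bounded_u_noise k t : (t <= T)%N ->
  mean_bounded P (fun w => frob (u_noise k t w) ^+ 2)
    ((1 - alpha) ^+ t * sg ^+ 2 + alpha * sg ^+ 2).
Proof.
have cg V := centered_inner (unb k) V.
have vg V := mean_bounded_sqr_frob (cg V) (integral_inner_variance (var k) V).
elim: t => [_|t IH tT] /=.
  apply: (@mean_bounded_fresh_xi k 0%N
    (fun w v => frob (inner (cl k) W0 v - inner_mean (cl k) W0) ^+ 2)
    (fun=> sg ^+ 2)) => //.
  - apply: measurable_funX; apply: measurable_frob; apply: measurable_mxB.
      by apply: measurable_inner => //; exact: measurable_mx_cst.
    exact: measurable_mx_cst.
  - by move=> w v; exact: sqr_ge0.
  - by move=> w; have [] := vg W0.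
  - apply: (@mean_bounded_weaken _ _ _ _ _ (sg ^+ 2)).
      by rewrite expr0 mul1r lerDl mulr_ge0 ?sqr_ge0 // ltW.
    by apply: mean_bounded_cst; exact: sqr_ge0.
apply: (@mean_bounded_fresh_xi k t.+1 (fun w v => frob ((1 - alpha) *: u_noise k t w +
    alpha *: (inner (cl k) (query k t.+1 w) v - inner_mean (cl k) (query k t.+1 w))) ^+ 2)
  (fun w => (1 - alpha) ^+ 2 * frob (u_noise k t w) ^+ 2 + alpha ^+ 2 * sg ^+ 2)) => //.
- apply: measurable_funX; apply: measurable_frob.
  have mq := @measurable_fresh_query k t.+1 tT k.
  apply: measurable_mxD; apply: measurable_mxZl.
    apply: (measurable_u_noise (measurable_fresh_xi_xi tT)) => //.
      exact: measurable_fresh_xi_zeta.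
    exact: ltnW.
  apply: measurable_mxB; first exact: measurable_inner.
  exact: measurable_inner_mean.
- by move=> w v; exact: sqr_ge0.
- move=> w; have [_ _] := mean_bounded_add_noise ((1 - alpha) *: u_noise k t w)
    alpha (cg (query k t.+1 w)) (vg (query k t.+1 w)).
  by rewrite frobZ exprMn real_normK ?num_real.
- apply: (@mean_bounded_weaken _ _ _ _ _ ((1 - alpha) ^+ 2 *
    ((1 - alpha) ^+ t * sg ^+ 2 + alpha * sg ^+ 2) + alpha ^+ 2 * sg ^+ 2)).
    have b0 : 0 <= (1 - alpha) ^+ t * sg ^+ 2 + alpha * sg ^+ 2.
      exact: mean_bounded_ge0 (IH (ltnW tT)).
    have : (1 - alpha) ^+ 2 * ((1 - alpha) ^+ t * sg ^+ 2 + alpha * sg ^+ 2) <=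
        (1 - alpha) * ((1 - alpha) ^+ t * sg ^+ 2 + alpha * sg ^+ 2).
      rewrite ler_wpM2r // expr2 ler_piMl ?subr_ge0 //.
      by rewrite gerBl ltW.
    move=> h; rewrite (exprS (1 - alpha) t) (le_trans (lerD h (lexx _))) // le_eqVlt.
    by apply/orP; left; apply/eqP; ring.
  apply: mean_boundedD; last first.
    by apply: mean_bounded_cst; rewrite mulr_ge0 ?sqr_ge0.
  by apply: mean_boundedZ; [exact: sqr_ge0|exact: IH (ltnW tT)].
Qed.

Definition M_noise_bound : R := sdg ^+ 2 * Cf ^+ 2 + Cg ^+ 2 * sf ^+ 2.

Let centered_jac k V h : centered_mx (inner_law (cl k))
  (fun v => (inner_jac v V - jac (inner_mean (cl k)) V) *m kron_id n h).
Proof. by apply: centered_mulmxr; exact: centered_inner_jac (unb k) V. Qed.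

Let jac_noise_variance k V h : frob h <= Cf -> mean_bounded (inner_law (cl k))
  (fun v => frob ((inner_jac v V - jac (inner_mean (cl k)) V) *m kron_id n h) ^+ 2)
  (sdg ^+ 2 * Cf ^+ 2).
Proof.
move=> hCf; have := mean_boundedZ (sqr_ge0 Cf) (mean_bounded_sqr_frob
  (centered_inner_jac (unb k) V) (integral_inner_jac_variance (var k) V)).
rewrite mulrC; apply: mean_bounded_le.
  apply: measurable_funX; apply: measurable_frob.
  exact: centered_measurable (centered_jac k V h).
move=> v; rewrite sqr_ge0 /= -exprMn ler_pXn2r ?nnegrE ?mulr_ge0 ?frob_ge0 ?(ltW Cf0) //.
by rewrite (le_trans (frob_mul_kron_id _ _)) // mulrC ler_wpM2r ?frob_ge0.
Qed.

Let centered_outer k y (J : 'M[R]_(m, d * n)) : centered_mx (outer_law (cl k))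
  (fun v => J *m kron_id n (outer_grad v y - grad (outer_mean (cl k)) y)).
Proof.
apply: centered_mulmxl; apply: centered_kron_id.
exact: centered_outer_grad (unb k) y.
Qed.

Let outer_noise_variance k y (J : 'M[R]_(m, d * n)) : mean_bounded (outer_law (cl k))
  (fun v => frob (J *m kron_id n (outer_grad v y - grad (outer_mean (cl k)) y)) ^+ 2)
  (frob J ^+ 2 * sf ^+ 2).
Proof.
have := mean_boundedZ (sqr_ge0 (frob J)) (mean_bounded_sqr_frob
  (centered_outer_grad (unb k) y) (integral_outer_grad_variance (var k) y)).
apply: mean_bounded_le.
  apply: measurable_funX; apply: measurable_frob.
  exact: centered_measurable (centered_outer k y J).
move=> v; rewrite sqr_ge0 /= -exprMn ler_pXn2r ?nnegrE ?mulr_ge0 ?frob_ge0 //.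
exact: frob_mul_kron_id.
Qed.

Lemma frob_query_grad k t w : frob (query_grad k t w) <= Cf.
Proof. exact: (frob_grad_outer_mean Cf0 (unb k) (var k) (mom k)). Qed.

(** Two conditionings per step: zeta is integrated out with xi of the same time frozen, and [H1]
    integrates xi out with the past frozen. The bound is stationary for v |-> (1 - beta) v + beta^2
    [M_noise_bound], and the noise starts at 0. *)
Lemma mean_bounded_M_noise k t : (t <= T)%N ->
  mean_bounded P (fun w => frob (M_noise k t w) ^+ 2) (beta * M_noise_bound).
Proof.
have c0 : 0 <= M_noise_bound by rewrite addr_ge0 // mulr_ge0 ?sqr_ge0.
have bc0 : 0 <= beta * M_noise_bound by rewrite mulr_ge0 // ltW.
elim: t => [_|t IH tT].
  under [X in mean_bounded _ X]eq_fun do rewrite /= frob0 expr0n.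
  apply: (mean_bounded_weaken bc0); exact: mean_bounded_cst.
have {}IH := IH (ltnW tT).
have H1 : mean_bounded P (fun w => frob ((1 - beta) *: M_noise k t w +
    beta *: jac_noise k t.+1 w) ^+ 2)
    ((1 - beta) ^+ 2 * (beta * M_noise_bound) + beta ^+ 2 * (sdg ^+ 2 * Cf ^+ 2)).
  apply: (@mean_bounded_fresh_xi k t.+1 (fun w v => frob ((1 - beta) *: M_noise k t w +
      beta *: ((inner_jac v (query k t.+1 w) - jac (inner_mean (cl k)) (query k t.+1 w))
        *m kron_id n (query_grad k t.+1 w))) ^+ 2)
    (fun w => (1 - beta) ^+ 2 * frob (M_noise k t w) ^+ 2 +
      beta ^+ 2 * (sdg ^+ 2 * Cf ^+ 2))) => //.
  - apply: measurable_funX; apply: measurable_frob.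
    have mq := @measurable_fresh_query k t.+1 tT k.
    apply: measurable_mxD; apply: measurable_mxZl.
      apply: (measurable_M_noise (measurable_fresh_xi_xi tT)) => //.
        exact: measurable_fresh_xi_zeta.
      exact: ltnW.
    apply: measurable_mxM.
      by apply: measurable_mxB; [exact: measurable_inner_jac|exact: measurable_jac_inner_mean].
    apply: measurable_kron_id; apply: measurable_grad_outer_mean => //.
    exact: measurable_inner_mean.
  - by move=> w v; exact: sqr_ge0.
  - move=> w; have [_ _] := mean_bounded_add_noise ((1 - beta) *: M_noise k t w)
      beta (centered_jac k (query k t.+1 w) (query_grad k t.+1 w))
      (jac_noise_variance k (query k t.+1 w) (frob_query_grad k t.+1 w)).
    by rewrite frobZ exprMn real_normK ?num_real.
  - apply: mean_boundedD; last first.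
      by apply: mean_bounded_cst; do 2 rewrite mulr_ge0 ?sqr_ge0 //.
    by apply: mean_boundedZ => //; exact: sqr_ge0.
apply: (@mean_bounded_fresh_zeta k t.+1 (fun w v => frob (((1 - beta) *: M_noise k t w +
    beta *: jac_noise k t.+1 w) + beta *: (sampled_jac k t.+1 w *m
      kron_id n (outer_grad v (u k t.+1 w) - grad (outer_mean (cl k)) (u k t.+1 w)))) ^+ 2)
  (fun w => frob ((1 - beta) *: M_noise k t w + beta *: jac_noise k t.+1 w) ^+ 2 +
     beta ^+ 2 * (frob (sampled_jac k t.+1 w) ^+ 2 * sf ^+ 2))) => //.
- apply: measurable_funX; apply: measurable_frob.
  pose phi (z : past (k, inord t.+1, false) * outer_space (cl k)) : Omega := z.1.
  have mx j s : (s < t.+1)%N -> (s <= T)%N ->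
      measurable_fun [set: past (k, inord t.+1, false) * outer_space (cl k)]
        (fun z => xi j s (phi z)).
    by move=> _; exact: measurable_fresh_zeta_xi.
  have mz j s : (s < t.+1)%N -> (s <= T)%N ->
      measurable_fun [set: past (k, inord t.+1, false) * outer_space (cl k)]
        (fun z => zeta j s (phi z)).
    exact: measurable_fresh_zeta_zeta.
  have mxk : measurable_fun [set: past (k, inord t.+1, false) * outer_space (cl k)]
      (fun z => xi k t.+1 (phi z)) by exact: measurable_fresh_zeta_xi.
  have mu : measurable_mx (fun z => u k t.+1 (phi z)) by exact: (measurable_u mx mz).
  apply: measurable_mxD; first apply: measurable_mxD; apply: measurable_mxZl.
  + by apply: (measurable_M_noise mx mz) => //; exact: ltnW.
  + exact: (measurable_jac_noise mx mz).
  + apply: measurable_mxM; first exact: (measurable_sampled_jac mx mz).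
    apply: measurable_kron_id; apply: measurable_mxB; first exact: measurable_outer_grad.
    exact: measurable_grad_outer_mean.
- by move=> w v; exact: sqr_ge0.
- move=> w; have [_ _] := mean_bounded_add_noise
    ((1 - beta) *: M_noise k t w + beta *: jac_noise k t.+1 w)
    beta (centered_outer k (u k t.+1 w) (sampled_jac k t.+1 w))
    (outer_noise_variance k (u k t.+1 w) (sampled_jac k t.+1 w)).
  by [].
- apply: (@mean_bounded_weaken _ _ _ _ _ ((1 - beta) ^+ 2 * (beta * M_noise_bound) +
    beta ^+ 2 * (sdg ^+ 2 * Cf ^+ 2) + beta ^+ 2 * (sf ^+ 2 * Cg ^+ 2))).
    have : (1 - beta) ^+ 2 * (beta * M_noise_bound) <=
        (1 - beta) * (beta * M_noise_bound).
      by rewrite ler_wpM2r // expr2 ler_piMl ?subr_ge0 // gerBl ltW.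
    rewrite -addrA => h; rewrite (le_trans (lerD h (lexx _))) // le_eqVlt.
    by apply/orP; left; apply/eqP; rewrite /M_noise_bound; ring.
  apply: mean_boundedD => //; apply: mean_boundedZ; first exact: sqr_ge0.
  under [X in mean_bounded _ X]eq_fun do rewrite mulrC.
  by apply: mean_boundedZ; [exact: sqr_ge0|exact: mean_bounded_sampled_jac].
Qed.

End Moments.

(** * Summation over the run *)

Section Total.
(** [lam] is the free weight in 2 a b <= lam a^2 + b^2 / lam. It will be T^(-1/4), the order of the
    root mean square of the noises after the transient. *)
Variables (lam Delta : R).
Hypothesis lam0 : 0 < lam.
Hypothesis gap : forall V, objective cl W0 - objective cl V <= Delta.

Let mid_xi k s : (s < T.+1)%N -> (s <= T)%N ->
  measurable_fun [set: Omega] (fun w => xi k s (id w)).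
Proof. by move=> _ _; exact: measurable_funPT (xi k s). Qed.

Let mid_zeta k s : (s < T.+1)%N -> (s <= T)%N ->
  measurable_fun [set: Omega] (fun w => zeta k s (id w)).
Proof. by move=> _ _; exact: measurable_funPT (zeta k s). Qed.

Let measurable_Wbar t : (t <= T)%N -> measurable_mx (Wbar t).
Proof.
by move=> tT; apply: measurable_average => k; exact: (measurable_W mid_xi mid_zeta).
Qed.

Let measurable_Mbar t : (t <= T)%N -> measurable_mx (Mbar t).
Proof.
by move=> tT; apply: measurable_average => k; exact: (measurable_M mid_xi mid_zeta).
Qed.

Let measurable_gradient t : (t <= T)%N ->
  measurable_mx (fun w => grad (objective cl) (Wbar t w)).
Proof.
move=> tT; under [X in measurable_mx X]eq_fun do rewrite (grad_objective dcl).
apply: measurable_average => k; apply: measurable_grad_client_obj => //.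
exact: measurable_Wbar.
Qed.

Let measurable_M_bias t : (t <= T)%N -> measurable_mx (M_bias t).
Proof.
move=> tT; apply: measurable_mxB.
  by apply: measurable_mxB; [exact: measurable_Mbar|exact: measurable_gradient].
by apply: measurable_average => k; exact: (measurable_M_noise mid_xi mid_zeta).
Qed.

Let measurable_M_spread t : (t <= T)%N -> measurable_fun [set: Omega] (M_spread t).
Proof.
move=> tT; apply: measurable_sum => k; apply: measurable_frob; apply: measurable_mxB.
  exact: (measurable_M mid_xi mid_zeta).
exact: measurable_Mbar.
Qed.

Lemma mean_bounded_mean (f : 'I_K -> Omega -> R) c :
  (forall k, mean_bounded P (f k) c) ->
  mean_bounded P (fun w => K%:R^-1 * \sum_k f k w) c.
Proof.
move=> fc; rewrite -(mean_const c K0); apply: mean_boundedZ; first by rewrite invr_ge0.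
exact: mean_bounded_sum.
Qed.

Local Notation e := (u_drift + Cg * rho).

Let e0 : 0 <= e.
Proof.
by rewrite addr_ge0 ?u_drift_ge0 // mulr_ge0 ?(ltW Cg0) // consensus_radius_ge0.
Qed.

(** The sure part of the error of u is paired with |J| <= (1 + |J|^2) / 2, and its noise with the
    weighted inequality, so that second moments of J suffice. *)
Definition tracking_bound t : R := `|Lf| * (e * ((1 + Cg ^+ 2) / 2) +
  (lam * Cg ^+ 2 + lam^-1 * ((1 - alpha) ^+ t * sg ^+ 2 + alpha * sg ^+ 2)) / 2).

Lemma mean_bounded_tracking t : (t <= T)%N ->
  mean_bounded P (fun w => K%:R^-1 * (\sum_k frob (sampled_jac k t w) *
    (`|Lf| * (e + frob (u_noise k t w))))) (tracking_bound t).
Proof.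
move=> tT; apply: mean_bounded_mean => k.
have HJ := mean_bounded_sampled_jac k tT.
have HN := mean_bounded_u_noise k tT.
have H : mean_bounded P (fun w => `|Lf| * (e * (2^-1 * (1 + frob (sampled_jac k t w) ^+ 2)) +
    2^-1 * (lam * frob (sampled_jac k t w) ^+ 2 + lam^-1 * frob (u_noise k t w) ^+ 2)))
    (tracking_bound t).
  have -> : tracking_bound t = `|Lf| * (e * (2^-1 * (1 + Cg ^+ 2)) + 2^-1 *
      (lam * Cg ^+ 2 + lam^-1 * ((1 - alpha) ^+ t * sg ^+ 2 + alpha * sg ^+ 2))).
    by rewrite /tracking_bound [in LHS](mulrC (1 + _)) [in LHS](mulrC (lam * _ + _)).
  apply: mean_boundedZ => //; apply: mean_boundedD.
    apply: mean_boundedZ => //; apply: mean_boundedZ => //.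
    by apply: mean_boundedD => //; exact: mean_bounded_cst.
  apply: mean_boundedZ => //; apply: mean_boundedD; apply: mean_boundedZ => //.
    exact: ltW.
  by rewrite invr_ge0 ltW.
apply: mean_bounded_le H.
  apply: measurable_funM.
    apply: measurable_frob; apply: (measurable_sampled_jac mid_xi mid_zeta) => //.
    exact: leqW.
  apply: measurable_funM => //; apply: measurable_funD => //.
  by apply: measurable_frob; exact: (measurable_u_noise mid_xi mid_zeta).
move=> w; have eu0 : 0 <= e + frob (u_noise k t w) := addr_ge0 e0 (frob_ge0 _).
rewrite mulr_ge0 ?frob_ge0 ?(mulr_ge0 _ eu0) //=.
rewrite mulrCA ler_wpM2l // mulrDr lerD //.
  rewrite mulrC ler_wpM2l //.
  by have := sqr_ge0 (1 - frob (sampled_jac k t w)); rewrite sqrrB; lra.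
(* AM-GM: 2 a b <= lam a^2 + b^2 / lam *)
have := mulr_ge0 (ltW lam0)
  (sqr_ge0 (frob (sampled_jac k t w) - lam^-1 * frob (u_noise k t w))).
move: (frob (sampled_jac k t w)) (frob (u_noise k t w)) => a b.
have -> : lam * (a - lam^-1 * b) ^+ 2 = lam * a ^+ 2 + lam^-1 * b ^+ 2 - 2 * (a * b).
  by field; rewrite gt_eqF.
by lra.
Qed.

Fixpoint M_bias_bound (t : nat) : R :=
  if t is s.+1 then (1 - beta) * (M_bias_bound s + L * (eta * sn)) +
    beta * (tracking_bound t + L * rho)
  else grad_bound + Cg * Cf.

Lemma mean_bounded_M_bias t : (t <= T)%N ->
  mean_bounded P (fun w => frob (M_bias t w)) (M_bias_bound t).
Proof.
elim: t => [_|t IH tT].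
  apply: (@mean_bounded_le _ _ _ _ _
    (fun w => K%:R^-1 * (\sum_k frob (sampled_grad k 0 w)) + Cg * Cf)).
  - by apply: measurable_frob; exact: measurable_M_bias.
  - by move=> w; rewrite frob_ge0 M_bias0.
  - apply: mean_boundedD; last by apply: mean_bounded_cst; rewrite mulr_ge0 // ltW.
    by apply: mean_bounded_mean => k; exact: mean_bounded_sampled_grad.
apply: (@mean_bounded_le _ _ _ _ _ (fun w =>
  (1 - beta) * (frob (M_bias t w) + L * (eta * sn)) +
    beta * (K%:R^-1 * (\sum_k frob (sampled_jac k t.+1 w) *
      (`|Lf| * (e + frob (u_noise k t.+1 w)))) + L * rho))).
- by apply: measurable_frob; exact: measurable_M_bias.
- by move=> w; rewrite frob_ge0 M_bias_succ.
apply: mean_boundedD; apply: mean_boundedZ; rewrite ?subr_ge0 ?(ltW beta_gt0) //.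
  apply: mean_boundedD; first exact: IH (ltnW tT).
  by apply: mean_bounded_cst; rewrite mulr_ge0.
apply: mean_boundedD; first exact: mean_bounded_tracking.
by apply: mean_bounded_cst; rewrite mulr_ge0 // consensus_radius_ge0.
Qed.

(** The first term is the spread of the unaveraged initial momenta, which lives until the first
    communication; the second counts the steps since the last one. *)
Definition M_spread_bound (t : nat) : R :=
  (t < tau)%:R * (2 * (K%:R * grad_bound)) +
  (t %% tau)%:R * (2 * (beta * (K%:R * grad_bound))).

Let grad_bound0 : 0 <= grad_bound.
Proof. by rewrite mulr_ge0 // addr_ge0 ?sqr_ge0. Qed.

Lemma mean_bounded_sum_sampled_grad t : (t <= T)%N ->
  mean_bounded P (fun w => \sum_k frob (sampled_grad k t w)) (K%:R * grad_bound).
Proof.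
move=> tT; have -> : K%:R * grad_bound = \sum_(k < K) grad_bound.
  by rewrite sumr_const card_ord mulr_natl.
by apply: mean_bounded_sum => k; exact: mean_bounded_sampled_grad.
Qed.

Lemma mean_bounded_M_spread t : (t <= T)%N ->
  mean_bounded P (M_spread t) (M_spread_bound t).
Proof.
have spread0 s w : 0 <= M_spread s w by apply: sumr_ge0 => k _; exact: frob_ge0.
have Kg0 : 0 <= K%:R * grad_bound by rewrite mulr_ge0.
have Kg1 : 0 <= 2 * (K%:R * grad_bound) by exact: mulr_ge0.
have Kg2 : 0 <= 2 * (beta * (K%:R * grad_bound)).
  by apply: mulr_ge0 => //; apply: mulr_ge0 => //; exact: ltW.
elim: t => [_|t IH tT].
  rewrite /M_spread_bound tau0 mod0n mul0r addr0 mul1r.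
  apply: (@mean_bounded_le _ _ _ _ _ (fun w => 2 * \sum_k frob (sampled_grad k 0 w))).
  - exact: measurable_M_spread.
  - by move=> w; rewrite spread0 M_spread0.
  - by apply: mean_boundedZ => //; exact: mean_bounded_sum_sampled_grad.
have [dt|ndt] := boolP (tau %| t.+1)%N.
  apply: (@mean_bounded_weaken _ _ _ _ _ 0).
    by apply: addr_ge0; apply: mulr_ge0.
  apply: (@mean_bounded_le _ _ _ _ _ (fun=> 0)); first exact: measurable_M_spread.
    by move=> w; rewrite spread0 (le_trans (M_spread_succ w tT)) // dt.
  exact: mean_bounded_cst.
apply: (@mean_bounded_weaken _ _ _ _ _ (M_spread_bound t + 2 * (beta * (K%:R * grad_bound)))).
  rewrite /M_spread_bound modnS (negPf ndt) -addrA lerD //.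
    rewrite ler_wpM2r // ler_nat.
    (* If t < tau then t + 1 < tau as well, since t + 1 = tau would be a communication round. *)
    case: (ltnP t tau) => //; rewrite leq_eqVlt => /orP[/eqP tt|-> //].
    by rewrite tt dvdnn in ndt.
  by rewrite -[(t %% tau).+1%:R]natr1 [leRHS]mulrDl mul1r.
apply: (@mean_bounded_le _ _ _ _ _ (fun w => M_spread t w +
  2 * (beta * \sum_k frob (sampled_grad k t.+1 w)))).
- exact: measurable_M_spread.
- by move=> w; rewrite spread0 (le_trans (M_spread_succ w tT)) // (negPf ndt).
apply: mean_boundedD; first exact: IH (ltnW tT).
apply: mean_boundedZ => //; apply: mean_boundedZ; first exact: ltW.
exact: mean_bounded_sum_sampled_grad.
Qed.

(** The errors of [descent_step] divided by eta, with the norm a of the momentum noise bounded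
    through a <= (lam + a^2 / lam) / 2. *)
Definition step_error_bound (t : nat) : R :=
  (1 + sn) * (M_bias_bound t + (lam + lam^-1 * (beta * M_noise_bound)) / 2 +
    K%:R^-1 * M_spread_bound t) + L * eta * n%:R.

(** Summing [descent_step] telescopes the objective, whose total decrease is at most Delta on every
    outcome. *)
Lemma mean_bounded_gradients :
  mean_bounded P (fun w => \sum_(t < T) frob (grad (objective cl) (Wbar t w)))
    (Delta / eta + \sum_(t < T) step_error_bound t).
Proof.
pose step t w := (1 + sn) * (frob (M_bias t w) +
  K%:R^-1 * (\sum_k frob (M_noise k t w)) + K%:R^-1 * M_spread t w) + L * eta * n%:R.
apply: (@mean_bounded_le _ _ _ _ _ (fun w => Delta / eta + \sum_(t < T) step t w)).
- apply: measurable_sum => t; apply: measurable_frob.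
  by apply: measurable_gradient; exact: ltnW.
- move=> w; rewrite sumr_ge0 /= => [|t _]; last exact: frob_ge0.
  rewrite -(ler_pM2l eta0) mulrDr [eta * (_ / _)]mulrC divfK ?gt_eqF //.
  have H N : (N <= T)%N -> eta * (\sum_(t < N) frob (grad (objective cl) (Wbar t w))) <=
      objective cl W0 - objective cl (Wbar N w) + eta * \sum_(t < N) step t w.
    elim: N => [_|N IH NT]; first by rewrite !big_ord0 Wbar0 subrr mulr0 addr0.
    rewrite !big_ord_recr /= !mulrDr.
    have := lerD (IH (ltnW NT)) (descent_step w NT) => /le_trans; apply.
    rewrite le_eqVlt; apply/orP; left; apply/eqP; rewrite /step; ring.
  by rewrite (le_trans (H T (leqnn _))) // lerD.
apply: mean_boundedD.
  apply: mean_bounded_cst; rewrite divr_ge0 ?(ltW eta0) //.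
  by rewrite (le_trans _ (gap W0)) // subrr.
apply: mean_bounded_sum => t; apply: mean_boundedD; last first.
  by apply: mean_bounded_cst; rewrite !mulr_ge0 // ltW.
have tT : (t <= T)%N by exact: ltnW.
apply: mean_boundedZ; first by rewrite addr_ge0.
apply: mean_boundedD; last first.
  by apply: mean_boundedZ; [rewrite invr_ge0|exact: mean_bounded_M_spread].
apply: mean_boundedD; first exact: mean_bounded_M_bias.
apply: mean_bounded_mean => k; rewrite mulrC.
have H : mean_bounded P (fun w => 2^-1 * (lam + lam^-1 * frob (M_noise k t w) ^+ 2))
    (2^-1 * (lam + lam^-1 * (beta * M_noise_bound))).
  apply: mean_boundedZ => //; apply: mean_boundedD.
    by apply: mean_bounded_cst; exact: ltW.
  by apply: mean_boundedZ; [rewrite invr_ge0 ltW|exact: mean_bounded_M_noise].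
apply: mean_bounded_le H.
  by apply: measurable_frob; exact: (measurable_M_noise mid_xi mid_zeta).
move=> w; rewrite frob_ge0 /=.
have := mulr_ge0 (ltW lam0) (sqr_ge0 (1 - lam^-1 * frob (M_noise k t w))).
move: (frob _) => a.
have -> : lam * (1 - lam^-1 * a) ^+ 2 = lam + lam^-1 * a ^+ 2 - 2 * a.
  by field; rewrite gt_eqF.
by lra.
Qed.

Lemma sum_geometric_le N : \sum_(t < N) (1 - alpha) ^+ t.+1 <= alpha^-1.
Proof.
have rec t : (1 - alpha) ^+ t.+2 <= (1 - alpha) * (1 - alpha) ^+ t.+1 + 0.
  by rewrite addr0 -exprS.
have /= := @sum_recursion_le R (fun t => (1 - alpha) ^+ t.+1) (fun=> 0) alpha N rec.
rewrite [X in _ <= _ + X]big1 // addr0 expr1 => H.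
have p0 : 0 <= (1 - alpha) ^+ N.+1 by rewrite exprn_ge0 // subr_ge0.
rewrite -[leRHS]mulr1 ler_pdivlMl //.
rewrite -subr_ge0; apply: le_trans p0 _; rewrite lerBrDr.
by apply: le_trans H _; rewrite gerBl ltW.
Qed.

(** [sum_recursion_le] with rate beta. The transient of the noise of u is summed as a geometric
    series, so it costs 1/alpha once instead of a factor T. *)
Lemma sum_M_bias_bound : \sum_(t < T) M_bias_bound t <=
  beta^-1 * (grad_bound + Cg * Cf + T%:R * (L * (eta * sn) +
    beta * (L * rho + `|Lf| * (e * ((1 + Cg ^+ 2) / 2) +
      (lam * Cg ^+ 2 + lam^-1 * (alpha * sg ^+ 2)) / 2)))
    + beta * (`|Lf| * (lam^-1 * sg ^+ 2 / 2) * alpha^-1)).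
Proof.
pose b t := L * (eta * sn) + beta * (tracking_bound t.+1 + L * rho).
have tb t : 0 <= tracking_bound t.
  apply: mulr_ge0 => //; apply: addr_ge0.
    by apply: mulr_ge0 => //; apply: divr_ge0 => //; apply: addr_ge0 => //; exact: sqr_ge0.
  apply: divr_ge0 => //; apply: addr_ge0; apply: mulr_ge0;
    rewrite ?sqr_ge0 ?invr_ge0 ?(ltW lam0) //.
  by apply: addr_ge0; apply: mulr_ge0;
    rewrite ?sqr_ge0 ?exprn_ge0 ?subr_ge0 ?(ltW alpha_gt0).
have Lr0 : 0 <= L * rho by apply: mulr_ge0 => //; exact: consensus_radius_ge0.
have Ls0 : 0 <= L * (eta * sn) by exact: mulr_ge0.
have b0 t : 0 <= M_bias_bound t.
  elim: t => [|t IH] /=.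
    by apply: addr_ge0 => //; apply: mulr_ge0; exact: ltW.
  apply: addr_ge0; apply: mulr_ge0; rewrite ?subr_ge0 ?(ltW beta_gt0) //.
    exact: addr_ge0.
  by apply: addr_ge0.
have rec t : M_bias_bound t.+1 <= (1 - beta) * M_bias_bound t + b t.
  rewrite /= mulrDr -addrA lerD // lerD //.
  by rewrite ler_piMl // gerBl ltW.
have := sum_recursion_le T rec; rewrite ler_pdivlMl //.
have := b0 T; move: (M_bias_bound T) (beta * \sum_(t < T) _) => x y x0 /= H.
apply: (@le_trans _ _ (grad_bound + Cg * Cf + \sum_(t < T) b t)).
  by move: H; lra.
rewrite -[leRHS]addrA lerD2l.
have -> : \sum_(t < T) b t = T%:R * (L * (eta * sn) +
    beta * (L * rho + `|Lf| * (e * ((1 + Cg ^+ 2) / 2) +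
      (lam * Cg ^+ 2 + lam^-1 * (alpha * sg ^+ 2)) / 2))) +
    beta * (`|Lf| * (lam^-1 * sg ^+ 2 / 2) * \sum_(t < T) (1 - alpha) ^+ t.+1).
  rewrite -sum_const_ord !mulr_sumr -big_split.
  by apply: eq_bigr => t _; rewrite /b /tracking_bound /=; ring.
rewrite lerD // ler_wpM2l ?(ltW beta_gt0) // ler_wpM2l ?sum_geometric_le //.
by rewrite mulr_ge0 // mulr_ge0 // mulr_ge0 ?sqr_ge0 // invr_ge0 ltW.
Qed.

(** The initial spread is present at most tau times, and t mod tau is below tau. *)
Lemma sum_M_spread_bound : K%:R^-1 * \sum_(t < T) M_spread_bound t <=
  tau%:R * (2 * grad_bound) + T%:R * (tau%:R * (2 * (beta * grad_bound))).
Proof.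
have -> : K%:R^-1 * \sum_(t < T) M_spread_bound t =
    (\sum_(t < T) (t < tau)%:R) * (2 * grad_bound) +
    (\sum_(t < T) (t %% tau)%:R) * (2 * (beta * grad_bound)).
  rewrite mulr_sumr !mulr_suml -big_split; apply: eq_bigr => t _.
  rewrite /M_spread_bound mulrDr /=.
  by congr (_ + _); field; rewrite pnatr_eq0 -lt0n.
apply: lerD.
  apply: ler_wpM2r; first exact: mulr_ge0.
  rewrite -natr_sum ler_nat.
  suff H N : (\sum_(t < N) (t < tau)%N <= minn N tau)%N.
    by rewrite (leq_trans (H T)) // geq_minr.
  elim: N => [|N IH]; first by rewrite big_ord0.
  rewrite big_ord_recr /=; case: (ltnP N tau) => h.
    by rewrite (minn_idPl h) addn1 ltnS (leq_trans IH) // geq_minl.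
  by rewrite addn0 (leq_trans IH) // leq_min geq_minr andbT (leq_trans (geq_minl _ _)).
rewrite [leRHS]mulrA; apply: ler_wpM2r.
  by apply: mulr_ge0 => //; apply: mulr_ge0 => //; exact: ltW.
rewrite -sum_const_ord; apply: ler_sum => t _.
by rewrite ler_nat ltnW // ltn_mod.
Qed.

Lemma sum_step_error_bound : \sum_(t < T) step_error_bound t =
  (1 + sn) * (\sum_(t < T) M_bias_bound t +
    T%:R * ((lam + lam^-1 * (beta * M_noise_bound)) / 2) +
    K%:R^-1 * \sum_(t < T) M_spread_bound t) + T%:R * (L * eta * n%:R).
Proof.
rewrite /step_error_bound big_split /= sum_const_ord; congr (_ + _).
rewrite -mulr_sumr; congr (_ * _).
by rewrite big_split /= -mulr_sumr; congr (_ + _); rewrite big_split /= sum_const_ord.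
Qed.

Lemma expected_gradients_le :
  (\sum_(t < T) 'E_P[fun w => frob (grad (objective cl) (average (fun k => W k t w)))]
    <= (Delta / eta + \sum_(t < T) step_error_bound t)%:E)%E.
Proof.
have [_ _] := mean_bounded_gradients; apply: le_trans.
rewrite (_ : (fun w => _) = (fun w => \sum_(t < T)
    (frob (grad (objective cl) (Wbar t w)))%:E)%E); last first.
  by apply/funext => w; rewrite sumEFin.
rewrite ge0_integral_sum //.
- by rewrite le_eqVlt; apply/orP; left; apply/eqP/eq_bigr => t _; rewrite unlock.
- move=> t; apply/measurable_EFinP/measurable_frob.
  by apply: measurable_gradient; exact: ltnW.
- by move=> t w _; rewrite lee_fin frob_ge0.
Qed.

End Total.

End Run.

(** * The rate *)

Section Rate.
Context {R : realType}.
Variables (n K : nat) (Delta sg sdg sf Cg Cf Lg Lf : R).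
Hypotheses (K0 : (0 < K)%N) (Cg0 : 0 < Cg) (Cf0 : 0 < Cf).

Local Notation sn := (Num.sqrt (n%:R : R)).
Local Notation L := (grad_lipschitz_constant Cg Cf Lg Lf).
Local Notation g1 := (grad_bound Cg Cf).
Local Notation c1 := (M_noise_bound sdg sf Cg Cf).

(** The final bound divided by x, where x = 1/q = T^(-1/4). Its nonconstant terms in x have
    nonnegative coefficients, so its value at 1 dominates it on [0, 1] and serves as the
    constant. *)
Definition rate (x : R) : R := Delta + (1 + sn) * (x * (g1 + Cg * Cf) + L * sn +
  2 * L * x * sn + `|Lf| * (Cg * ((1 + 4 * x) * sn) * ((1 + Cg ^+ 2) / 2) +
    (Cg ^+ 2 + sg ^+ 2) / 2) + `|Lf| * (sg ^+ 2 / 2) + (1 + c1) / 2 +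
  2 * g1 * x ^+ 2 + 2 * g1) + L * x ^+ 2 * n%:R.

Lemma rate_le x : 0 <= x <= 1 -> rate x <= rate 1.
Proof.
case/andP=> x0 x1; have x2 : x ^+ 2 <= 1 by rewrite expr_le1.
have g0 : 0 <= g1 by rewrite mulr_ge0 // addr_ge0 ?sqr_ge0.
have s0 : 0 <= sn by exact: sqrtr_ge0.
have l0 : 0 <= L by exact: grad_lipschitz_constant_ge0.
have A0 : 0 <= g1 + Cg * Cf by apply: addr_ge0 => //; apply: mulr_ge0; exact: ltW.
rewrite /rate expr1n; apply: lerD; last first.
  by apply: ler_wpM2r => //; apply: ler_wpM2l.
rewrite lerD2l; apply: ler_wpM2l; first exact: addr_ge0.
apply: lerD => //; apply: lerD; last by apply: ler_wpM2l => //; exact: mulr_ge0.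
rewrite !lerD2r; apply: lerD; last first.
  apply: ler_wpM2l => //; rewrite lerD2r; apply: ler_wpM2r.
    by apply: divr_ge0 => //; apply: addr_ge0 => //; exact: sqr_ge0.
  apply: ler_wpM2l; first exact: ltW.
  by apply: ler_wpM2r => //; rewrite lerD2l ler_wpM2l.
apply: lerD.
  by rewrite lerD2r; apply: ler_wpM2r.
by apply: ler_wpM2r => //; apply: ler_wpM2l => //; exact: mulr_ge0.
Qed.

Lemma average_step_error_le (q T : nat) (x : R) :
  (2 <= q)%N -> x = q%:R^-1 -> T = (q ^ 4)%N ->
  T%:R^-1 * (Delta / x ^+ 3 + \sum_(t < T)
    @step_error_bound R K n sg sdg sf Cg Cf Lg Lf (x ^+ 3) (x ^+ 2) (x ^+ 2) q x t)
  <= rate 1 * x.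
Proof.
move=> q2 xE TE; have q0 : 0 < q%:R :> R by rewrite ltr0n (leq_trans _ q2).
have x0 : 0 < x by rewrite xE invr_gt0.
have x1 : x <= 1 by rewrite xE invf_le1 // ler1n (leq_trans _ q2).
have Ex : q%:R = x^-1 by rewrite xE invrK.
have ET : T%:R = (x ^+ 4)^-1 by rewrite TE natrX Ex exprVn.
have x2 : 0 < x ^+ 2 <= 1 by rewrite exprn_gt0 //= expr_le1 // ltW.
apply: (@le_trans _ _ (rate x * x)); last first.
  by rewrite ler_wpM2r ?(ltW x0) // rate_le // (ltW x0).
have HB := @sum_M_bias_bound R n sg Cg Cf Lg Lf T _ _ _ q Cg0 Cf0
  (exprn_gt0 3 x0) x2 x2 x x0.
have HS := @sum_M_spread_bound R K Cg Cf T _ q K0 x2 (leq_trans (isT : 0 < 2)%N q2).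
rewrite sum_step_error_bound ET invrK.
have sn1 : 0 <= 1 + sn by rewrite addr_ge0 // sqrtr_ge0.
(* With eta = x^3, alpha = beta = x^2, lam = x and T = x^-4, the bound assembled from [HB] and [HS]
   is exactly [rate x * x]. *)
rewrite (_ : rate x * x = x ^+ 4 * (Delta / x ^+ 3 + ((1 + sn) *
    ((x ^+ 2)^-1 * (g1 + Cg * Cf + T%:R * (L * (x ^+ 3 * sn) +
    x ^+ 2 * (L * (@consensus_radius R n (x ^+ 3) q) + `|Lf| *
      ((@u_drift R n Cg (x ^+ 3) (x ^+ 2) q + Cg * @consensus_radius R n (x ^+ 3) q)
        * ((1 + Cg ^+ 2) / 2) +
      (x * Cg ^+ 2 + x^-1 * (x ^+ 2 * sg ^+ 2)) / 2)))
    + x ^+ 2 * (`|Lf| * (x^-1 * sg ^+ 2 / 2) * (x ^+ 2)^-1)) +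
    (x ^+ 4)^-1 * ((x + x^-1 * (x ^+ 2 * c1)) / 2) +
    (q%:R * (2 * g1) + T%:R * (q%:R * (2 * (x ^+ 2 * g1))))) +
    (x ^+ 4)^-1 * (L * x ^+ 3 * n%:R)))); last first.
  rewrite /rate /u_drift /consensus_radius ET Ex; field.
  by rewrite gt_eqF.
apply: ler_wpM2l; first by rewrite exprn_ge0 // ltW.
rewrite lerD2l lerD2r; apply: ler_wpM2l => //.
by apply: lerD => //; rewrite lerD2r.
Qed.

End Rate.

Lemma powR_quartic (R : realType) (q j : nat) :
  (q ^ 4)%N%:R `^ (j%:R / 4) = q%:R ^+ j :> R.
Proof.
rewrite natrX -powR_mulrn // -powRrM -powR_mulrn //; congr (_ `^ _).
by rewrite mulrCA divff ?mulr1 // pnatr_eq0.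
Qed.

Lemma powR_quarticN (R : realType) (q j : nat) :
  (q ^ 4)%N%:R `^ (- (j%:R / 4)) = q%:R^-1 ^+ j :> R.
Proof. by rewrite powRN powR_quartic exprVn. Qed.

Lemma card_mkset (I : finType) (p : pred I) : #|[set i | p i]| = #|p|.
Proof. by apply: eq_card => i; apply/idP/idP; rewrite inE. Qed.

(** Samples are drawn at times 0 to T, hence T + 1 draws of each of the two kinds. *)
Lemma samples_per_clientE (K T : nat) (k : 'I_K) :
  @samples_per_client K T k = (2 * T.+1)%N.
Proof.
rewrite /samples_per_client card_mkset.
rewrite (eq_card (B := finset.setX (finset.setX (finset.set1 k) [set: 'I_T.+1]%SET)
   [set: bool]%SET)); last first.
  by case=> -[j t] b; rewrite !finset.inE /= !andbT.
by rewrite !cardsX cards1 !cardsT card_ord card_bool mul1n mulnC.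
Qed.

Lemma comm_roundsE (q T : nat) : (0 < q)%N -> comm_rounds q T = (T %/ q)%N.
Proof.
move=> q0; rewrite /comm_rounds card_mkset -sum1_card big_mkcond /=.
elim: T => [|N IH]; first by rewrite big_ord0 div0n.
by rewrite big_ord_recr /= IH divnS // addnC; congr (_ + _)%N.
Qed.

Theorem mainTheorem3 (R : realType) (n K : nat)
    (Delta sg sdg sf Cg Cf Lg Lf delta : R)
    (hn : (1 <= n)%N) (hK : (1 <= K)%N)
    (hsg : 0 < sg) (hsdg : 0 < sdg) (hsf : 0 < sf)
    (hCg : 0 < Cg) (hCf : 0 < Cf) (hdelta : 0 <= delta) :
  exists C C' : R,
  forall (m d : nat) (cl : 'I_K -> client R m n d) (W0 : 'M[R]_(m, n)),
    (1 <= m)%N -> (1 <= d)%N ->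
    (forall k, regular_client (cl k)) ->
    has_lbound (range (objective cl)) ->
    objective cl W0 - inf (range (objective cl)) = Delta ->
    (forall k, unbiased (cl k)) ->
    (forall k, bounded_variance sg sdg sf (cl k)) ->
    (forall k, bounded_second_moment Cg Cf (cl k)) ->
    (forall k, smooth Lg Lf (cl k)) ->
    bounded_heterogeneity delta cl ->
    (forall T q : nat, (2 <= T)%N -> (q ^ 4 = T)%N ->
       fedcomuon_bound cl W0 T (T%:R `^ (- (3 / 4)))
         (T%:R `^ (- (1 / 2))) (T%:R `^ (- (1 / 2))) q
         (C * T%:R `^ (- (1 / 4)))) /\
    (forall eps : R, 0 < eps <= 1 ->
       exists T q : nat,
         [/\ (2 <= T)%N, (q ^ 4 = T)%N &
         [/\ fedcomuon_bound cl W0 T (T%:R `^ (- (3 / 4)))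
               (T%:R `^ (- (1 / 2))) (T%:R `^ (- (1 / 2))) q eps,
             T%:R <= C' * eps ^- 4,
             forall k : 'I_K, (@samples_per_client K T k)%:R <= C' * eps ^- 4
           & [/\ (comm_rounds q T)%:R = T%:R / q%:R :> R,
                 T%:R / q%:R = T%:R `^ (3 / 4) :> R
               & T%:R / q%:R <= C' * eps ^- 3]]]).
Proof.
set C := rate n Delta sg sdg sf Cg Cf Lg Lf 1.
(* B dominates C, so that C / q <= eps once q >= B / eps, and B >= 2 forces q >= 2. *)
set B := `|C| + 2.
have B2 : 2 <= B by rewrite lerDr.
(* 2 B bounds q eps, and the factor 4 absorbs the 2 (T + 1) <= 4 T samples. *)
exists C, (4 * (2 * B) ^+ 4) => m d cl W0 _ _ reg lb gapE unb var mom smo _.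
have gap V : objective cl W0 - objective cl V <= Delta.
  by rewrite -gapE lerD2l lerN2; apply: ge_inf => //; exists V.
have bound T q : (2 <= T)%N -> (q ^ 4 = T)%N ->
    fedcomuon_bound cl W0 T (T%:R `^ (- (3 / 4)))
      (T%:R `^ (- (1 / 2))) (T%:R `^ (- (1 / 2))) q (C * q%:R^-1).
  move=> T2 qT; have q2 : (2 <= q)%N by case: q qT T2 => [|[|q]] <-.
  have q0 : 0 < q%:R :> R by rewrite ltr0n (leq_trans _ q2).
  pose x : R := q%:R^-1; have x0 : 0 < x by rewrite invr_gt0.
  have x1 : x <= 1 by rewrite invf_le1 // ler1n (leq_trans _ q2).
  have p3 : T%:R `^ (- (3 / 4)) = x ^+ 3 by rewrite -qT (powR_quarticN R q 3).
  have p2 : T%:R `^ (- (1 / 2)) = x ^+ 2.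
    by rewrite -qT (_ : 1 / 2 = 2 / 4) ?(powR_quarticN R q 2) //; field.
  rewrite p3 p2 => dO Omega P xi zeta W Wt M Mt u fresh run.
  have x2 : 0 < x ^+ 2 <= 1 by rewrite exprn_gt0 //= expr_le1 // ltW.
  have H := expected_gradients_le hK hCg hCf reg unb var mom smo (exprn_gt0 3 x0)
    x2 x2 (leq_trans (isT : 0 < 2)%N q2) fresh run x0 gap.
  have T0 : 0 <= T%:R^-1 :> R by rewrite invr_ge0.
  have T0E : (0 <= (T%:R^-1 : R)%:E)%E by rewrite lee_fin.
  rewrite /average_grad_norm (le_trans (lee_wpmul2l T0E H)) // -EFinM lee_fin.
  exact: average_step_error_le.
split.
  move=> T q T2 qT; have -> : T%:R `^ (- (1 / 4)) = q%:R^-1 :> R.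
    by rewrite -qT; exact: (powR_quarticN R q 1).
  exact: bound.
move=> eps /andP[eps0 eps1].
have Be0 : 0 <= B / eps by rewrite divr_ge0 ?(ltW eps0) // (le_trans _ B2).
have /andP[le1 lt1] := truncn_itv Be0.
(* Rounding up keeps q between B / eps and 2 B / eps. *)
pose q := (Num.truncn (B / eps)).+1.
have Bq : B <= q%:R * eps by rewrite -ler_pdivrMr // ltW.
have Be1 : 2 <= B / eps by rewrite ler_pdivlMr // (le_trans _ B2) // ler_piMr.
have q2 : (2 <= q)%N by rewrite -(ler_nat R) (le_trans Be1) // ltW.
have q0 : 0 < q%:R :> R by rewrite ltr0n.
have qB : q%:R <= 2 * B * eps^-1.
  by rewrite /q -natr1 -mulrA mulr_natl mulr2n lerD // (le_trans _ Be1) // ler1n.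
have qj j : q%:R ^+ j <= (2 * B) ^+ j * eps ^- j.
  rewrite -exprVn -exprMn; case: j => [|j]; first by rewrite !expr0.
  by rewrite ler_pXn2r ?nnegrE ?(le_trans _ qB) // ltW.
have B21 : 1 <= 2 * B by move: B2; lra.
have C0 : 0 <= (2 * B) ^+ 4 by rewrite exprn_ge0 // (le_trans _ B21).
have e4 : 0 <= eps ^- 4 by rewrite invr_ge0 exprn_ge0 // ltW.
have qq : (q <= q ^ 4)%N by rewrite -{1}(expn1 q) leq_pexp2l // (leq_trans _ q2).
have T2 : (2 <= q ^ 4)%N by exact: leq_trans qq.
have EQ : (q ^ 4)%N%:R / q%:R = q%:R ^+ 3 :> R.
  by rewrite natrX exprSr mulfK // gt_eqF.
exists (q ^ 4)%N, q; split=> //; split.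
- move=> dO Omega P xi zeta W Wt M Mt u fresh run.
  rewrite (le_trans (bound _ _ T2 erefl _ _ _ _ _ _ _ _ _ _ fresh run)) // lee_fin.
  rewrite ler_pdivrMr // mulrC (le_trans _ Bq) // /B.
  by rewrite (le_trans (ler_norm C)) // lerDl.
- rewrite natrX (le_trans (qj 4%N)) // ler_wpM2r //.
  by rewrite ler_peMl // ler1n.
- move=> k; rewrite samples_per_clientE.
  apply: (@le_trans _ _ (4 * q%:R ^+ 4)).
    rewrite -natrX -natrM ler_nat mulnS -[X in (_ <= X * _)%N]/(2 + 2)%N mulnDl.
    by rewrite leq_add2r (leq_trans T2) // leq_pmull.
  by rewrite -mulrA ler_wpM2l.
- split.
  + by rewrite comm_roundsE // EQ expnSr mulnK // natrX.
  + by rewrite EQ (powR_quartic R q 3).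
  + rewrite EQ (le_trans (qj 3%N)) // ler_wpM2r //.
      by rewrite invr_ge0 exprn_ge0 // ltW.
    apply: (@le_trans _ _ ((2 * B) ^+ 4)); last by rewrite ler_peMl // ler1n.
    by rewrite ler_weXn2l.
Qed.
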